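(* There exists a numerical constant $c>0$ such that for any $\sigma>0$, any $\Delta>0$, any integer $d\geq 1$, any $\theta>0$, any $\delta\in(0,1/12)$, and any integers $N,K$ with $N\geq 2K\geq 4$ such that $\mathcal{E}(\Delta,\theta,\sigma,N,K,d)\neq\emptyset$, $$T^*(\delta,\mathcal{E}(\Delta,\theta,\sigma,N,K,d))\;\geq\; cN+c\,\frac{\sigma^2}{\Delta^2}\left[N\log\left(\frac{N}{\delta}\right)+\sqrt{dKN\log\left(\frac{N}{\delta}\right)}\right].$$
   Context: Active clustering problem. There are $N$ arms indexed by $[N]$; arm $a$ has an unknown distribution $\nu_a$ on $\mathbb{R}^d$ with mean $\mu_a$. An environment is $\nu=(\nu_a)_{a\in[N]}$ satisfying: (i) ($\sigma$-subGaussian) for each arm $a$ there is a symmetric $d\times d$ matrix $\Sigma_a$ with $\|\Sigma_a\|_{op}\leq\sigma^2$ such that, for $X\sim\nu_a$, the coordinates $E_i$ of $E=\Sigma_a^{-1/2}(X-\mu_a)$ are independent and satisfy $\mathbb{E}[\exp(tE_i)]\leq\exp(t^2/2)$ for all $t\in\mathbb{R}$; (ii) (hidden partition) there is a partition $G^*=\{G^*_1,\dots,G^*_K\}$ of $[N]$ into $K$ nonempty groups such that $\mu_a=\mu_b$ iff $a,b$ lie in the same group; $\mu(k)$ denotes the common mean of $G^*_k$. Define $\Delta_*=\min_{k\neq k'}\|\mu(k)-\mu(k')\|$ (Euclidean norm) and $\theta_*=\min_k |G^*_k|/N$. $\mathcal{E}(\Delta,\theta,\sigma,N,K,d)$ is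 the set of such environments with $N$ arms, $K$ groups, $d$-dimensional observations, parameter $\sigma$, and $\Delta_*\geq\Delta$, $\theta_*\geq\theta$. A strategy interacts sequentially: at each time $t$ it chooses an arm $A_t$ based on past arms/observations (and possibly independent external randomness), then observes $X_t\sim\nu_{A_t}$ independently given the past; it stops at a stopping time $\tau$ (the budget) with respect to the filtration $\mathcal{F}_t=\sigma(A_1,X_1,\dots,A_t,X_t)$ and outputs an $\mathcal{F}_\tau$-measurable partition $\hat G$ of $[N]$ into $K$ groups. Two partitions are equivalent, $G\sim G'$, if they coincide up to relabelling of the groups. A strategy $\pi$ is $\delta$-PAC on a set of environments $\mathcal{E}$ if $\mathbb{P}_{\pi,\nu}(\hat G\sim G^* )\geq 1-\delta$ for every $\nu\in\mathcal{E}$. The optimal worst-case budget is $T^*(\delta,\mathcal{E})=\inf_{\pi\ \delta\text{-PAC on }\mathcal{E}}\ \sup_{\nu\in\mathcal{E}}\mathbb{E}_{\pi,\nu}[\tau]$. *)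

(* Defs.v *)
From HB Require Import structures.
From mathcomp Require Import all_boot all_order all_algebra.
From mathcomp Require Import all_classical all_reals all_analysis.
From mathcomp Require Import Rstruct Rstruct_topology.
From mathcomp Require Import perm.

Set Implicit Arguments.
Unset Strict Implicit.
Unset Printing Implicit Defensive.

Import Order.TTheory GRing.Theory Num.Theory.
Local Open Scope classical_set_scope.
Local Open Scope ring_scope.

Section ActiveClustering.
Variable R : realType.

(* Observations in R^d are d.-tuples of reals (product Borel sigma-algebra).
   A history of length t is a t.-tuple of (arm index, observation) pairs,
   the arm index being stored as a natural number (discrete sigma-algebra). *)
Definition hist_elem (d : nat) := (nat * d.-tuple R)%type.

Definition vnorm (d : nat) (x : 'cV[R]_d) : R := Num.sqrt (\sum_i (x i 0) ^+ 2).

Definition colv (d : nat) (x : d.-tuple R) : 'cV[R]_d := \col_i (tnth x i).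

(* Partitions of [N] into K groups are given by labelings 'I_N -> 'I_K;
   equivalence = equality up to relabelling of the groups. *)
Definition part_equiv (N K : nat) (G G' : {ffun 'I_N -> 'I_K}) : Prop :=
  exists s : {perm 'I_K}, forall a, G' a = s (G a).

(* A strategy: arm choices A_{t+1} = st_arm t (U, H_t) (U = external randomness),
   stopping rule  {tau = t} = {st_stop t H_t}  (so tau is the first such t, a
   stopping time w.r.t. F_t = sigma(H_t)), and recommendation
   hat G = st_rec tau H_tau (F_tau-measurable).  All maps are measurable. *)
Local Unset Implicit Arguments.
Record strategy (N K d : nat) := Strategy {
  st_arm : forall t : nat, (R * t.-tuple (hist_elem d))%type -> 'I_N;
  st_stop : forall t : nat, t.-tuple (hist_elem d) -> bool;
  st_rec : forall t : nat, t.-tuple (hist_elem d) -> {ffun 'I_N -> 'I_K};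
  st_arm_meas : forall t (a : 'I_N), measurable (st_arm t @^-1` [set a]);
  st_stop_meas : forall t, measurable (st_stop t @^-1` [set true]);
  st_rec_meas : forall t (G : {ffun 'I_N -> 'I_K}), measurable (st_rec t @^-1` [set G]);
  st_rec_part : forall t h (k : 'I_K), exists a, st_rec t h a = k
}.
Local Set Implicit Arguments.
Arguments st_arm {N K d} s t.
Arguments st_stop {N K d} s t.
Arguments st_rec {N K d} s t.

Section Process.
Context (N K d : nat) (pi : strategy N K d) {dO : measure_display} {Omega : measurableType dO}.
Variables (U : Omega -> R) (Y : 'I_N -> nat -> Omega -> d.-tuple R).

(* Y a s = the s-th sample drawn from arm a ("stack of rewards" model);
   H_t = history after t rounds. *)
Fixpoint hist (t : nat) (w : Omega) : t.-tuple (hist_elem d) :=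
  match t with
  | 0 => [tuple]
  | t'.+1 =>
      let h := hist t' w in
      let a := st_arm pi t' (U w, h) in
      rcons_tuple h (nat_of_ord a, Y a (count (fun e : hist_elem d => e.1 == nat_of_ord a) h) w)
  end.

(* the budget tau (in \bar R, +oo if the strategy never stops) *)
Definition tau (w : Omega) : \bar R :=
  ereal_inf [set ((t%:R)%:E : \bar R) | t in [set t | st_stop pi t (hist t w)]].

Definition correct (G : {ffun 'I_N -> 'I_K}) : set Omega :=
  [set w | exists t, (forall t', (t' < t)%N -> ~~ st_stop pi t' (hist t' w)) /\
                     st_stop pi t (hist t w) /\ part_equiv G (st_rec pi t (hist t w))].

End Process.

Section Environment.
Context (N d : nat) {dO : measure_display} {Omega : measurableType dO}.
Variables (P : probability Omega R) (U : Omega -> R) (Y : 'I_N -> nat -> Omega -> d.-tuple R).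

(* (U, (Y a s)_{a,s}) is a mutually independent family, U is uniform on [0,1]
   (external randomness), and for each arm a the samples Y a s are identically
   distributed (with law nu_a := law of Y a 0). *)
Definition realization : Prop :=
  [/\ measurable_fun setT U,
      (forall a s, measurable_fun setT (Y a s)),
      (forall A : set R, measurable A ->
         P (U @^-1` A) = lebesgue_measure (A `&` [set x : R | 0 <= x <= 1])),
      (forall a s (B : set (d.-tuple R)), measurable B ->
         P (Y a s @^-1` B) = P (Y a 0 @^-1` B)) &
      (forall (S : seq ('I_N * nat)) (A : set R) (B : 'I_N -> nat -> set (d.-tuple R)),
         uniq S -> measurable A -> (forall a s, measurable (B a s)) ->
         fine (P (U @^-1` A `&` \bigcap_(p in [set p | p \in S]) (Y p.1 p.2 @^-1` B p.1 p.2)))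
         = fine (P (U @^-1` A)) * \prod_(p <- S) fine (P (Y p.1 p.2 @^-1` B p.1 p.2)))].

Definition arm_mean (a : 'I_N) (mu : 'cV[R]_d) : Prop :=
  forall i : 'I_d, P.-integrable setT (fun w => (tnth (Y a 0 w) i)%:E) /\
    (\int[P]_w (tnth (Y a 0 w) i)%:E = (mu i 0)%:E)%E.

(* sigma-subGaussian condition for arm a with mean mu:
   Sig symmetric, ||Sig||_op <= sigma^2, S = Sig^{1/2} (the symmetric positive
   definite square root), E = S^{-1} (X - mu) has independent 1-subGaussian coordinates. *)
Definition arm_subgaussian (sigma : R) (a : 'I_N) (mu : 'cV[R]_d) : Prop :=
  exists Sig S : 'M[R]_d,
    [/\ Sig^T = Sig,
        (forall x : 'cV[R]_d, vnorm (Sig *m x) <= sigma ^+ 2 * vnorm x),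
        S^T = S /\ (forall x : 'cV[R]_d, x != 0 -> 0 < (x^T *m S *m x) 0 0),
        S *m S = Sig &
        let E := fun w => invmx S *m (colv (Y a 0 w) - mu) in
        (forall B : 'I_d -> set R, (forall i, measurable (B i)) ->
           fine (P (\bigcap_i ((fun w => E w i 0) @^-1` B i)))
           = \prod_i fine (P ((fun w => E w i 0) @^-1` B i))) /\
        (forall (i : 'I_d) (t : R),
           (\int[P]_w (expR (t * E w i 0))%:E <= (expR (t ^+ 2 / 2))%:E)%E)].

Definition in_env_class (Delta theta sigma : R) (K : nat) (G : {ffun 'I_N -> 'I_K}) : Prop :=
  exists mu : 'I_N -> 'cV[R]_d,
    [/\ (forall a, arm_mean a (mu a)) /\ (forall a, arm_subgaussian sigma a (mu a)),
        forall k : 'I_K, exists a, G a = k,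
        forall a b, mu a = mu b <-> G a = G b,
        forall a b, G a != G b -> Delta <= vnorm (mu a - mu b) &
        forall k : 'I_K, theta <= #|[set a | G a == k]|%:R / N%:R].

End Environment.

Definition env_nonempty (Delta theta sigma : R) (N K d : nat) : Prop :=
  exists (dO : measure_display) (Omega : measurableType dO) (P : probability Omega R)
         (U : Omega -> R) (Y : 'I_N -> nat -> Omega -> d.-tuple R) (G : {ffun 'I_N -> 'I_K}),
    realization P U Y /\ in_env_class P Y Delta theta sigma G.

Definition delta_PAC (delta Delta theta sigma : R) (N K d : nat) (pi : strategy N K d) : Prop :=
  forall (dO : measure_display) (Omega : measurableType dO) (P : probability Omega R)
         (U : Omega -> R) (Y : 'I_N -> nat -> Omega -> d.-tuple R) (G : {ffun 'I_N -> 'I_K}),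
    realization P U Y -> in_env_class P Y Delta theta sigma G ->
    ((1 - delta)%:E <= P (correct pi U Y G))%E.

Definition worst_budget (Delta theta sigma : R) (N K d : nat) (pi : strategy N K d) : \bar R :=
  ereal_sup [set e | exists (dO : measure_display) (Omega : measurableType dO)
         (P : probability Omega R) (U : Omega -> R) (Y : 'I_N -> nat -> Omega -> d.-tuple R)
         (G : {ffun 'I_N -> 'I_K}),
    [/\ realization P U Y, in_env_class P Y Delta theta sigma G &
        e = (\int[P]_w tau pi U Y w)%E]].

Definition Tstar (delta Delta theta sigma : R) (N K d : nat) : \bar R :=
  ereal_inf [set worst_budget Delta theta sigma pi |
             pi in [set pi : strategy N K d | delta_PAC delta Delta theta sigma pi]].

End ActiveClustering.

(* Main.v *)
Require Import Defs.
From HB Require Import structures.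
From mathcomp Require Import all_boot all_order all_algebra.
From mathcomp Require Import all_classical all_reals all_analysis.
From mathcomp Require Import Rstruct Rstruct_topology.
From mathcomp Require Import measurable_realfun exp perm zify ring lra.
From Stdlib Require Rdefinitions.
Set Implicit Arguments.
Unset Strict Implicit.
Unset Printing Implicit Defensive.
Import Order.TTheory GRing.Theory Num.Theory.
Local Open Scope ring_scope.

(* The hard instances come from a grid of disjoint pairs of arms: for each vector [s] of
   bits, one per pair, the pair [i] is swapped between the groups [2j] and [2j + 1]
   according to [s i], whereas the arms of the first row are never moved, so that distinct
   vectors give inequivalent partitions. Averaging over [s] and over the pair [i], a
   procedure of budget [b] is correct under [s] with probability close to [1] while
   sampling the pair [i] at most [O(b / N)] times and the two groups at most [O(b / K)]
   times, but under the vector obtained by flipping [s i] it gives this answer with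
   probability at most [delta] over the number of pairs. The second moment of the
   likelihood ratio between the two vectors, on this event, is hence at least of order
   [N / delta].

   Observations have [d] independent two-point coordinates, of means [(1 + g) / 2] or
   [(1 - g) / 2] up to translation and scaling. If the sign of each coordinate is known,
   then the second moment is at most [exp (O (Delta^2 / sigma^2) b / N)], which gives the
   terms [N] and [N log (N / delta)]. If the signs are uniform and shared by the groups
   [2j] and [2j + 1], the likelihoods become mixtures, and the second moment is at most
   [exp (O (d g^4) (b / N) (b / K))], which gives the square root. *)

(** * Stopped sums over histories, and the averaging argument *)

(** Two-point observations leave finitely many histories of a given length, so a law on histories is
    a finite sum of terms [alpha h * W s h], where the strategy factor [alpha] is common to all
    vectors [s] and only [W] changes with [s]; no densities are involved. The obstacle is to control
    the second moment of [W s / W (flip s i)] along an adaptively chosen path, when both terms are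
    mixtures. It is done by a potential [Z] with [W s ^+ 2 <= Z * W (flip s i)] whose sum over the
    next outcome is at most its current value, whichever arm is chosen. Its value at the empty
    history then bounds the second moment for every strategy at once. A potential with a small
    initial value can be afforded only while the sampling counts stay below fixed caps, whence the
    restriction to histories with few samples. Since signs are drawn independently across
    coordinates, mixtures factor over coordinates: a potential for one coordinate suffices, and its
    initial value gets raised to the power [d]. *)

Section StoppedSum.
Context {R : realFieldType} {T : finType} (stop : pred (seq T)).

(** Sum over the leaves of the tree of histories extending [h], cut where [stop] holds or after [n]
    further rounds. When [F] is a probability weight times a statistic, this is the expectation of
    the statistic at the smaller of the stopping time and the horizon. *)
Fixpoint stopped_sum (n : nat) (F : seq T -> R) (h : seq T) : R :=
  if stop h then F h else
  if n is n'.+1 then \sum_(e : T) stopped_sum n' F (rcons h e) else F h.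

Lemma stopped_sum_le n (F G : seq T -> R) h :
  (forall h', stop h' || (size h' == size h + n)%N -> F h' <= G h') ->
  stopped_sum n F h <= stopped_sum n G h.
Proof.
elim: n h => [|n IH] h FG /=; first by case: ifP => sh; apply: FG; rewrite ?sh ?addn0 ?eqxx ?orbT.
case: ifP => sh; first by apply: FG; rewrite sh.
apply: ler_sum => e _; apply: IH => h' ; rewrite size_rcons addSnnS; exact: FG.
Qed.

Lemma eq_stopped_sum n (F G : seq T -> R) h :
  F =1 G -> stopped_sum n F h = stopped_sum n G h.
Proof.
by move=> FG; apply/eqP; rewrite eq_le; apply/andP; split;
   apply: stopped_sum_le => h' _; rewrite FG.
Qed.

Lemma stopped_sumD n (F G : seq T -> R) h :
  stopped_sum n (fun h => F h + G h) h = stopped_sum n F h + stopped_sum n G h.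
Proof.
elim: n h => [|n IH] h /=; case: ifP => // _.
by rewrite -big_split; apply: eq_bigr => e _; rewrite IH.
Qed.

Lemma stopped_sumZ n c (F : seq T -> R) h :
  stopped_sum n (fun h => c * F h) h = c * stopped_sum n F h.
Proof.
elim: n h => [|n IH] h /=; case: ifP => // _.
by rewrite mulr_sumr; apply: eq_bigr => e _; rewrite IH.
Qed.

Lemma stopped_sum_sum n (I : Type) (r : seq I) (F : I -> seq T -> R) h :
  stopped_sum n (fun h => \sum_(i <- r) F i h) h = \sum_(i <- r) stopped_sum n (F i) h.
Proof.
elim: n h => [|n IH] h /=; case: ifP => // _.
by rewrite exchange_big; apply: eq_bigr => e _; rewrite IH.
Qed.

Lemma stopped_sum_supermartingale n (Z : seq T -> R) h :
  (forall h, ~~ stop h -> \sum_(e : T) Z (rcons h e) <= Z h) ->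
  stopped_sum n Z h <= Z h.
Proof.
move=> HZ; elim: n h => [|n IH] h /=; case: ifP => // /negbT sh.
by apply: le_trans (HZ _ sh); apply: ler_sum => e _; exact: IH.
Qed.

End StoppedSum.

Section StoppedPrefix.
Context {R : realFieldType} {T : finType} (stop : pred (seq T)).

Fixpoint stopped_prefix (h r : seq T) : seq T :=
  if stop h then h else if r is e :: r' then stopped_prefix (rcons h e) r' else h.

Lemma stopped_prefixP h r : exists k, [/\ (k <= size r)%N,
  stopped_prefix h r = h ++ take k r,
  forall j, (j < k)%N -> ~~ stop (h ++ take j r) &
  stop (h ++ take k r) || (k == size r)].
Proof.
elim: r h => [|e r IH] h /=.
  by exists 0; split => //; rewrite ?cats0 ?orbT// if_same.
case: ifPn => [sh|nsh]; first by exists 0; split => //; rewrite cats0 ?sh.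
have [k [kr -> nst st]] := IH (rcons h e).
exists k.+1; split => //; rewrite ?cat_rcons//=; last by rewrite -cat_rcons.
by move=> [|j] jk /=; [rewrite cats0|rewrite -cat_rcons; exact: nst].
Qed.

Lemma sum_tuple0 (F : seq T -> R) : \sum_(r : 0.-tuple T) F r = F [::].
Proof.
rewrite (bigD1 [tuple])//= big1 ?addr0// => r; case/eqP.
by apply: val_inj; case: r => -[].
Qed.

Lemma sum_tupleS n (F : seq T -> R) :
  \sum_(r : n.+1.-tuple T) F r = \sum_(e : T) \sum_(r : n.-tuple T) F (e :: r).
Proof.
rewrite pair_bigA /= (reindex (fun p : T * n.-tuple T => [tuple of p.1 :: p.2])) //=.
exists (fun r : n.+1.-tuple T => (thead r, [tuple of behead r])).
  by move=> [e r] _ /=; congr (_, _); apply: val_inj.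
by move=> r _; rewrite -tuple_eta.
Qed.

(** Bridge from full paths of fixed length to the stopped tree: by consistency of [p], the weights
    of all continuations of a stopped history add up to its own weight. *)
Lemma sum_stopped_prefix (p G : seq T -> R) n h :
  (forall h, \sum_(e : T) p (rcons h e) = p h) ->
  \sum_(r : n.-tuple T) G (stopped_prefix h r) * p (h ++ r) =
  stopped_sum stop n (fun h => p h * G h) h.
Proof.
move=> pS.
have p_sum m h' : \sum_(r : m.-tuple T) p (h' ++ r) = p h'.
  elim: m h' => [|m IH] h'; first by rewrite (sum_tuple0 (fun r => p (h' ++ r))) cats0.
  rewrite (sum_tupleS _ (fun r => p (h' ++ r))) -[RHS]pS; apply: eq_bigr => e _.
  by rewrite -IH; apply: eq_bigr => r _; rewrite cat_rcons.
elim: n h => [|n IH] h.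
  rewrite (sum_tuple0 (fun r => G (stopped_prefix h r) * p (h ++ r))).
  by rewrite /= cats0 !if_same mulrC.
rewrite (sum_tupleS _ (fun r => G (stopped_prefix h r) * p (h ++ r))) /=.
case: ifPn => sh; last first.
  by apply: eq_bigr => e _; rewrite -IH; apply: eq_bigr => r _; rewrite cat_rcons.
rewrite -(sum_tupleS _ (fun r => G h * p (h ++ r))) -mulr_sumr.
by rewrite (p_sum n.+1) mulrC.
Qed.

Lemma stopped_sum_martingale (p : seq T -> R) n h :
  (forall h, \sum_(e : T) p (rcons h e) = p h) -> stopped_sum stop n p h = p h.
Proof.
move=> pS; elim: n h => [|n IH] h /=; first by rewrite if_same.
by case: ifP => // _; rewrite -[RHS]pS; apply: eq_bigr.
Qed.

End StoppedPrefix.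

(** A pointwise Cauchy-Schwarz inequality without square roots: the geometric mean of [k * w'] and
    [k^-1 * z] is at most their arithmetic mean. Being linear in [w'] and [z], it can be summed over
    histories. *)
Lemma amgm_weight {R : realFieldType} (w w' z k : R) :
  0 < k -> 0 <= w -> 0 <= w' -> 0 <= z -> w ^+ 2 <= z * w' ->
  w <= (k * w' + k^-1 * z) / 2.
Proof.
move=> k0 w0 w'0 z0 H.
have b0 : 0 <= k^-1 * z by rewrite mulr_ge0// invr_ge0 ltW.
have a0 : 0 <= k * w' by rewrite mulr_ge0// ltW.
have ab : w ^+ 2 <= (k * w') * (k^-1 * z).
  by rewrite mulrACA divff ?gt_eqF// mul1r mulrC.
move: (k * w') (k^-1 * z) a0 b0 ab => a b a0 b0 ab.
rewrite ler_pdivlMr//; rewrite -(@ler_pXn2r _ 2)// ?nnegrE; [|lra|lra].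
have := sqr_ge0 (a - b); nra.
Qed.

(** * Averaging over the hypercube of swap vectors *)

Section Hypercube.
Context {I : finType}.
Definition flip (s : {ffun I -> bool}) (i : I) : {ffun I -> bool} :=
  [ffun i' => s i' (+) (i' == i)].
Lemma flipK i : involutive (flip^~ i).
Proof. by move=> s; apply/ffunP => i'; rewrite !ffunE -addbA addbb addbF. Qed.
Lemma flip_neq s i : flip s i != s.
Proof. by apply/eqP => /ffunP /(_ i); rewrite ffunE eqxx addbT; case: (s i). Qed.
Lemma flip_inj s : injective (flip s).
Proof.
move=> i k /ffunP /(_ i); rewrite !ffunE eqxx; case: eqP => //.
by rewrite addbT addbF; case: (s i).
Qed.
End Hypercube.

Section HypercubeBound.
Context {R : realFieldType} {A X I : finType}.
Local Notation T := (A * X)%type.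
Local Notation S := {ffun I -> bool}.
Variables (stop : pred (seq T)) (ok : S -> pred (seq T)).
Variables (alpha : seq T -> R) (alphaS : seq T -> A -> R) (W : S -> seq T -> R).
Variables (P G : I -> pred A) (delta B V : R) (H Q Ta Tj : nat).

Local Notation cnt p h := (count (fun e : T => p e.1) h).
Let C i h := (cnt (P i) h <= Ta)%N && (cnt (G i) h <= Tj)%N.
Let Ex s (f : seq T -> R) := stopped_sum stop H (fun h => alpha h * W s h * f h) [::].

Hypotheses (alpha_ge0 : forall h, 0 <= alpha h) (alphaS_ge0 : forall h a, 0 <= alphaS h a) (W_ge0 : forall s h, 0 <= W s h).
Hypotheses (alpha0 : alpha [::] = 1)
  (alpha_rcons : forall h a x, alpha (rcons h (a, x)) = alphaS h a)
  (alpha_sum : forall h, \sum_a alphaS h a = alpha h).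
Hypothesis ok_excl : forall s s' h, ok s h -> ok s' h -> s = s'.
Hypotheses (Ex1 : forall s, Ex s (fun=> 1) = 1)
  (Ex_ok : forall s, 1 - delta <= Ex s (fun h => (~~ stop h || ok s h)%:R))
  (Ex_size : forall s, Ex s (fun h => (size h)%:R) <= B).
Hypotheses (P_sum : forall a, (\sum_i P i a <= 1)%N) (G_sum : forall a, (\sum_i G i a <= Q)%N).
Hypotheses (delta_lt : delta < 1 / 12) (I_gt0 : (0 < #|I|)%N) (H_gt0 : (0 < H)%N).
Hypotheses (H_large : 32 * B <= H%:R) (Ta_large : 32 * B <= #|I|%:R * Ta.+1%:R)
  (Tj_large : 32 * (Q%:R * B) <= #|I|%:R * Tj.+1%:R).
Hypothesis V_gt0 : 0 < V.
(** [Z] plays the role of [W s ^+ 2 / W (flip s i)], replaced by a supermartingale for the counting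
    measure on outcomes. Everything is required only on [C i], that is, below the caps [Ta] and
    [Tj]. *)
Hypothesis potential : forall s i, exists Z : seq T -> R,
  [/\ Z [::] <= V, forall h, C i h -> 0 <= Z h,
      forall h a, C i h -> (forall x, C i (rcons h (a, x))) ->
        \sum_x Z (rcons h (a, x)) <= Z h &
      forall h, C i h -> W s h ^+ 2 <= Z h * W (flip s i) h].

Lemma Ex_le s f g :
  (forall h, stop h || (size h == H)%N -> f h <= g h) -> Ex s f <= Ex s g.
Proof.
move=> fg; apply: stopped_sum_le => h hs.
by apply: ler_wpM2l; [exact: mulr_ge0 | exact: fg].
Qed.

Lemma ExD s f g : Ex s (fun h => f h + g h) = Ex s f + Ex s g.
Proof. by rewrite -stopped_sumD; apply: eq_stopped_sum => h; rewrite mulrDr. Qed.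

Lemma ExZ s c f : Ex s (fun h => c * f h) = c * Ex s f.
Proof. by rewrite -stopped_sumZ; apply: eq_stopped_sum => h; rewrite mulrCA. Qed.

Lemma Ex_sum s (J : Type) (r : seq J) f :
  Ex s (fun h => \sum_(i <- r) f i h) = \sum_(i <- r) Ex s (f i).
Proof. by rewrite -stopped_sum_sum; apply: eq_stopped_sum => h; rewrite mulr_sumr. Qed.

Lemma count_sum_le (p : I -> pred A) (q : nat) (h : seq T) :
  (forall a, (\sum_i p i a <= q)%N) -> (\sum_i cnt (p i) h <= q * size h)%N.
Proof.
move=> pq; elim: h => [|e h IH]; first by rewrite big1.
rewrite /= big_split /= mulnS; exact: leq_add.
Qed.

(** Markov's inequality applied to all indices together: an arm counts for at most [q] of them, so
    the counts add up to at most [q] times the length of the history. *)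
Lemma Ex_count_gt s (p : I -> pred A) (q t : nat) :
  (forall a, (\sum_i p i a <= q)%N) -> 32 * (q%:R * B) <= #|I|%:R * t.+1%:R ->
  \sum_i Ex s (fun h => (t < cnt (p i) h)%N%:R) <= #|I|%:R / 32.
Proof.
move=> pq qB.
have t0 : (0 : R) < t.+1%:R by rewrite ltr0n.
suff : t.+1%:R * (\sum_i Ex s (fun h => (t < cnt (p i) h)%N%:R)) <= q%:R * B.
  move=> le1; rewrite -(ler_pM2l t0).
  move: (\sum_i _) t.+1%:R le1 qB => Y u; move: (q%:R * B) (#|I|%:R) => v N le1 qB; lra.
rewrite mulr_sumr; under eq_bigr => i _ do rewrite -ExZ.
rewrite -Ex_sum.
apply: (@le_trans _ _ (Ex s (fun h => q%:R * (size h)%:R))); last first.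
  by rewrite ExZ ler_wpM2l.
apply: Ex_le => h _; rewrite -natrM.
apply: (@le_trans _ _ (\sum_i cnt (p i) h)%:R); last by rewrite ler_nat count_sum_le.
rewrite natr_sum; apply: ler_sum => i _; rewrite -natrM ler_nat.
by case: leqP => //= le; rewrite ?muln1 ?muln0.
Qed.

Lemma Ex_nstop s : Ex s (fun h => (~~ stop h)%:R) <= 1 / 32.
Proof.
have H0 : (0 : R) < H%:R by rewrite ltr0n.
suff : H%:R * Ex s (fun h => (~~ stop h)%:R) <= B.
  move=> le1; rewrite -(ler_pM2l H0); move: (Ex s _) H%:R le1 H_large => Y u le1 uB; lra.
(* Markov again: a leaf of the tree that is not stopped has length exactly [H]. *)
rewrite -ExZ; apply: le_trans (Ex_size s); apply: Ex_le => h.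
by case: (stop h) => /= [_|/eqP ->]; rewrite ?mulr0 ?mulr1.
Qed.

(** Multiplying by the indicator of [C i] kills the potential when a cap is exceeded. Counts only
    grow, so it never comes back, and nonnegativity of [Z] keeps the supermartingale property at the
    killing step. Whether a step leaves [C i] depends on the arm and not on the outcome. *)
Lemma alphaZ_le i (Z : seq T -> R) :
  (forall h, C i h -> 0 <= Z h) ->
  (forall h a, C i h -> (forall x, C i (rcons h (a, x))) ->
        \sum_x Z (rcons h (a, x)) <= Z h) ->
  stopped_sum stop H (fun h => alpha h * (Z h * (C i h)%:R)) [::] <= Z [::].
Proof.
move=> Z0 Zs.
have C0 : C i [::] by [].
suff -> : Z [::] = (fun h => alpha h * (Z h * (C i h)%:R)) [::].
  apply: stopped_sum_supermartingale => h _.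
  pose f a x := alpha (rcons h (a, x)) * (Z (rcons h (a, x)) * (C i (rcons h (a, x)))%:R).
  rewrite (eq_bigr (fun e => f e.1 e.2)) => [|[]//]; rewrite -(pair_bigA _ f) /= {}/f.
  rewrite -alpha_sum mulr_suml; apply: ler_sum => a _.
  under eq_bigr => x _ do rewrite alpha_rcons.
  rewrite -mulr_sumr ler_wpM2l//.
  have [Ch|nCh] := boolP (C i h); last first.
    rewrite mulr0 big1// => x _; have [|] := boolP (C i _); last by rewrite mulr0.
    rewrite /C -!cats1 !count_cat => /andP[/(leq_trans (leq_addr _ _)) c1 /(leq_trans (leq_addr _ _)) c2].
    by rewrite /C c1 c2 in nCh.
  rewrite mulr1.
  have Cax x y : C i (rcons h (a, x)) = C i (rcons h (a, y)) by rewrite /C -!cats1 !count_cat.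
  have [/forallP Cx|/forallPn[y nCy]] := boolP [forall x, C i (rcons h (a, x))].
    by under eq_bigr => x _ do rewrite Cx mulr1; exact: Zs.
  by rewrite big1 ?Z0// => x _; rewrite (Cax x y) (negbTE nCy) mulr0.
by rewrite alpha0 C0 mul1r mulr1.
Qed.

Lemma Ex_flip s i :
  Ex s (fun h => (stop h && ok s h && C i h)%:R) <=
  (V * Ex (flip s i) (fun h => (stop h && ok s h)%:R) + 1) / 2.
Proof.
have [Z [Z0V Z0 Zs ZW]] := potential s i.
rewrite -ExZ.
(* The weight in [amgm_weight] is [V], so that the total mass of [V^-1 * Z] is at most 1. *)
apply: (@le_trans _ _ ((Ex (flip s i) (fun h => V * (stop h && ok s h)%:R) +
   V^-1 * stopped_sum stop H (fun h => alpha h * (Z h * (C i h)%:R)) [::]) / 2)); last first.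
  rewrite ler_pM2r ?invr_gt0// lerD2l ler_pdivrMl// mulr1.
  exact: le_trans (alphaZ_le Z0 Zs) Z0V.
rewrite -stopped_sumZ -stopped_sumD mulrC -stopped_sumZ.
apply: stopped_sum_le => h _.
have [sok|] := boolP (stop h && ok s h); last first.
  rewrite !mulr0 add0r => _; rewrite mulr_ge0 ?invr_ge0// mulr_ge0 ?invr_ge0 ?(ltW V_gt0)//.
  by rewrite mulr_ge0//; case: (boolP (C i h)) => [/Z0|]; rewrite ?mulr1 ?mulr0.
have [Ch|nCh] := boolP (C i h); last first.
  by rewrite !mulr0 addr0 mulr1 mulr_ge0 ?invr_ge0// !mulr_ge0// ltW.
rewrite !mulr1.
have := amgm_weight V_gt0 (W_ge0 s h) (W_ge0 (flip s i) h) (Z0 _ Ch) (ZW _ Ch).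
move=> /(ler_wpM2l (alpha_ge0 h)); congr (_ <= _).
by field; rewrite gt_eqF.
Qed.

(** On average over [s], the inequalities combine into [(1 - delta - 3/32) * #|I| <= (V * delta +
    #|I|) / 2], hence [(1 - 2 * delta - 3/16) * #|I| <= V * delta], and [delta < 1/12] leaves more
    than [3/5]. *)
Lemma hypercube_bound : 3 / 5 * #|I|%:R <= V * delta.
Proof.
pose E1 s i := Ex s (fun h => (stop h && ok s h && C i h)%:R).
pose E2 s i := Ex (flip s i) (fun h => (stop h && ok s h)%:R).
have I0 : (0 : R) < #|I|%:R by rewrite ltr0n.
have low s : (1 - delta - 3 / 32) * #|I|%:R <= \sum_i E1 s i.
  have := Ex_count_gt s P_sum (t := Ta); rewrite mul1r => /(_ Ta_large) cP.
  have cG := Ex_count_gt s G_sum Tj_large.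
  have eok := Ex_ok s; have ens := Ex_nstop s.
  (* A path counted on the left is either a good one or falls under one of three failures: horizon
     reached, pair sampled too often, groups sampled too often. Each failure costs [1/32]. *)
  have : \sum_(i : I) Ex s (fun h => (~~ stop h || ok s h)%:R) <=
     \sum_i (E1 s i + Ex s (fun h => (~~ stop h)%:R) + Ex s (fun h => (Ta < cnt (P i) h)%N%:R)
         + Ex s (fun h => (Tj < cnt (G i) h)%N%:R)).
    apply: ler_sum => i _; rewrite -!ExD; apply: Ex_le => h _.
    rewrite /C -!natrD ler_nat !ltnNge.
    by case: (stop h); case: (ok s h); case: (_ <= Ta)%N; case: (_ <= Tj)%N.
  rewrite !big_split /= !sumr_const -!(mulr_natr (Ex _ _)).
  move: (\sum_i _) (\sum_i _) (\sum_i _) cP cG => x y z cP cG.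
  move: (Ex s _) (Ex s _) eok ens => u v eok ens.
  have /(ler_wpM2r (ltW I0)) := eok; have /(ler_wpM2r (ltW I0)) := ens; lra.
(* Under a fixed [s], the answers for the vectors [flip s i] exclude each other and also exclude
   [ok s]; together they share a mass of at most [delta]. *)
have up s : \sum_i Ex s (fun h => (stop h && ok (flip s i) h)%:R) <= delta.
  have -> : delta = 1 - (1 - delta) by ring.
  rewrite lerBrDr; apply: le_trans (lerD (lexx _) (Ex_ok s)) _.
  rewrite -Ex_sum -ExD -[leRHS](Ex1 s); apply: Ex_le => h _.
  rewrite -natr_sum -natrD -[leRHS]/(1%:R) ler_nat; case: (stop h) => /=; last by rewrite big1.
  case: (boolP (ok s h)) => [oks|noks].
    rewrite big1// => i _; case: (boolP (ok _ h)) => // /(ok_excl oks) /esym/eqP.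
    by rewrite (negbTE (flip_neq _ _)).
  rewrite addn0; case: (pickP (fun i => ok (flip s i) h)) => [i oki|no]; last first.
    by rewrite big1// => i _; rewrite no.
  rewrite (bigD1 i)//= oki big1// => k ki; case: (boolP (ok _ h)) => // /(ok_excl oki) /flip_inj ik.
  by rewrite ik eqxx in ki.
have : \sum_(s : S) (1 - delta - 3 / 32) * #|I|%:R <= \sum_s \sum_i E1 s i.
  by apply: ler_sum => s _; exact: low.
have : \sum_s \sum_i E1 s i <= \sum_s \sum_i (V * E2 s i + 1) / 2.
  by apply: ler_sum => s _; apply: ler_sum => i _; exact: Ex_flip.
(* For each [i], the involution [flip^~ i] exchanges the true vector and the answered one, which
   turns [E2] into the quantity bounded by [up]. *)
have -> : \sum_s \sum_i (V * E2 s i + 1) / 2 =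
   (V * (\sum_s \sum_i Ex s (fun h => (stop h && ok (flip s i) h)%:R)) + #|S|%:R * #|I|%:R) / 2.
  rewrite exchange_big /=.
  transitivity (\sum_i (V * \sum_s E2 s i + #|S|%:R) / 2).
    apply: eq_bigr => i _; rewrite -mulr_suml big_split /= -mulr_sumr sumr_const.
    by rewrite -[1 *+ _]/(_%:R).
  rewrite -mulr_suml big_split /= -mulr_sumr sumr_const -[in LHS](mulr_natr _ #|I|).
  congr ((V * _ + _) / 2); rewrite [RHS]exchange_big /=; apply: eq_bigr => i _.
  rewrite (reindex_inj (inv_inj (flipK i))); apply: eq_bigr => s _.
  by rewrite /E2 flipK.
have : V * (\sum_s \sum_i Ex s (fun h => (stop h && ok (flip s i) h)%:R)) <= V * (\sum_(s : S) delta).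
  by apply: ler_wpM2l; [exact: ltW | apply: ler_sum => s _; exact: up].
have sc (c : R) : \sum_(s : S) c = c * #|S|%:R by rewrite sumr_const mulr_natr.
rewrite !sc.
have S0 : (0 : R) < #|S|%:R by rewrite ltr0n; apply/card_gt0P; exists [ffun=> true].
move: (\sum_s _) (\sum_s _) (#|S|%:R : R) (#|I|%:R : R) S0 I0 => x y u v u0 v0 h1 h2 h3.
rewrite -(ler_pM2r u0).
have dI : delta * (v * u) <= 1 / 12 * (v * u).
  by rewrite ler_wpM2r ?mulr_ge0// ltW.
have := mulr_gt0 u0 v0.
lra.
Qed.

End HypercubeBound.

(** * Independent bits from a uniform variable *)

Local Open Scope classical_set_scope.
Local Open Scope ring_scope.

Section FiniteValued.
Context {R : realType} {d} {Omega : measurableType d} (P : probability Omega R).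
Context {F : finType} (g : Omega -> F).
Hypothesis mg : forall c, measurable (g @^-1` [set c]).

Lemma measurable_fin_preimage (Q : set F) : measurable (g @^-1` Q).
Proof.
rewrite (_ : g @^-1` Q = \bigcup_(c in Q) g @^-1` [set c]).
  by apply: fin_bigcup_measurable.
by apply/seteqP; split=> [w Qw|w [c Qc] /= ->//]; exists (g w).
Qed.

Lemma measurable_fin_comp d' (T : measurableType d') (f : F -> T) :
  measurable_fun setT (f \o g).
Proof.
move=> _ Y mY; rewrite setTI -[X in measurable X]/(g @^-1` (f @^-1` Y)).
exact: measurable_fin_preimage.
Qed.

Lemma probability_fin_preimage (Q : pred F) :
  fine (P (g @^-1` [set c | Q c])) = \sum_(c | Q c) fine (P (g @^-1` [set c])).
Proof.
rewrite -[RHS]big_filter.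
have : forall c, Q c <-> c \in [seq c <- index_enum F | Q c].
  by move=> c; rewrite mem_filter mem_index_enum andbT.
move: [seq _ <- _ | _] (filter_uniq Q (index_enum_uniq F)) => s us Qs.
rewrite (_ : [set c | Q c] = [set` s]); last by apply/seteqP; split=> c /Qs.
elim: s us {Qs} => [|c s IH] /=; first by rewrite big_nil set_nil preimage_set0 measure0.
move=> /andP[cs us]; rewrite big_cons -IH//.
rewrite (_ : [set` c :: s] = [set c] `|` [set` s]); last first.
  apply/seteqP; split=> x /=; rewrite in_cons; first by case/predU1P; [left|right].
  by case=> [->|->]; rewrite ?eqxx ?orbT.
rewrite preimage_setU measureU.
- by rewrite fineD ?fin_num_measure//; exact: measurable_fin_preimage.
- exact: mg.
- exact: measurable_fin_preimage.
- by apply/seteqP; split => // w [/= ->]; rewrite (negbTE cs).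
Qed.

Lemma fin_comp_indicE (f : F -> R) w :
  f (g w) = \sum_c f c * \1_(g @^-1` [set c]) w.
Proof.
rewrite (bigD1 (g w))//= big1 ?addr0 => [|c cg].
  by rewrite indicE mem_set// mulr1.
by rewrite indicE memNset ?mulr0// => /= gc; rewrite gc eqxx in cg.
Qed.

Lemma integrable_fin_comp (f : F -> R) : P.-integrable setT (fun w => (f (g w))%:E).
Proof.
rewrite (_ : (fun w => _) =
   (fun w => (\sum_c (f c)%:E * (\1_(g @^-1` [set c]) w)%:E)%E)).
  apply: integrable_sum => // c _; apply: integrableZl => //.
  exact: integrable_indic.
by apply/funext => w; rewrite fin_comp_indicE -sumEFin; apply: eq_bigr => c _; rewrite EFinM.
Qed.

Lemma integral_fin_comp (f : F -> R) :
  (\int[P]_w (f (g w))%:E = (\sum_c f c * fine (P (g @^-1` [set c])))%:E)%E.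
Proof.
under eq_integral => w _.
  rewrite fin_comp_indicE -sumEFin; under eq_bigr => c _ do rewrite EFinM.
  over.
have ii c : P.-integrable setT (fun w => (\1_(g @^-1` [set c]) w : R)%:E).
  exact: integrable_indic.
rewrite integral_sum//; last by move=> c; apply: integrableZl.
rewrite -sumEFin; apply: eq_bigr => c _.
rewrite integralZl// integral_indic// setIT EFinM fineK// fin_num_measure//.
Qed.

End FiniteValued.

Section BitSplitting.
Context {R : realType}.

(* A uniform point of [0, 1] is turned into independent biased bits: it falls left of
   [p 0] or not, and its position within the selected part is rescaled to [0, 1]. *)
Fixpoint split_bit (p : nat -> R) (n : nat) (x : R) : bool :=
  if n is n'.+1 then
    split_bit (p \o S) n' (if x < p 0 then x / p 0 else (x - p 0) / (1 - p 0))
  else x < p 0.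

Lemma measurable_split_bit p n : measurable_fun setT (split_bit p n).
Proof.
elim: n p => [|n IH] p /=; first exact: measurable_fun_ltr.
apply: (measurableT_comp (IH _)) => /=.
apply: measurable_fun_ifT.
- exact: measurable_fun_ltr.
- exact: measurable_funM.
- apply: measurable_funM => //; exact: measurable_funB.
Qed.

(** The rescalings are increasing and affine on each side of [p 0], so prescribing one more bit
    shrinks a half-open interval to a subinterval in the right proportion. *)
Lemma split_bit_itv (p : nat -> R) (b : nat -> bool) (n : nat) :
  (forall k, 0 < p k < 1) ->
  exists l r, [/\ 0 <= l, r <= 1,
    r - l = \prod_(0 <= k < n) (if b k then p k else 1 - p k) &
    forall x, 0 <= x < 1 ->
      ((forall k, (k < n)%N -> split_bit p k x = b k) <-> l <= x < r)].
Proof.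
elim: n p b => [|n IH] p b p01.
  by exists 0, 1; split=> //; rewrite big_nil subr0.
have [l [r [l0 r1 rl H]]] := IH (p \o S) (b \o S) (fun k => p01 k.+1).
have /andP[p0 p1] := p01 0.
have q0 : 0 < 1 - p 0 by rewrite subr_gt0.
have lr : l < r.
  rewrite -subr_gt0 rl; apply: prodr_gt0 => k _.
  by have /andP[? ?] := p01 k.+1; case: ifP; rewrite ?subr_gt0.
pose y x := if x < p 0 then x / p 0 else (x - p 0) / (1 - p 0).
have y01 x : 0 <= x < 1 -> 0 <= y x < 1.
  move=> /andP[x0 x1]; rewrite /y; case: ltP => xp.
    by rewrite divr_ge0 ?(ltW p0)//= ltr_pdivrMr// mul1r.
  by rewrite divr_ge0 ?(ltW q0) ?subr_ge0//= ltr_pdivrMr// mul1r ltrD2r.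
have step x : 0 <= x < 1 -> ((forall k, (k < n.+1)%N -> split_bit p k x = b k) <->
    (x < p 0) = b 0 /\ l <= y x < r).
  move=> x01; rewrite -H ?y01//; split=> [Hx|[H0 Hn] [|k] kn]; [split|..] => //.
  - exact: (Hx 0).
  - by move=> k kn; exact: (Hx k.+1).
  - exact: Hn.
rewrite big_nat_recl//=; case: (b 0) step => step.
  exists (p 0 * l), (p 0 * r); split.
  - by rewrite mulr_ge0// ltW.
  - by rewrite mulr_ile1// ltW// (le_lt_trans l0).
  - by rewrite -rl; ring.
  move=> x x01; rewrite (step _ x01) /y; split.
    by move=> [->]; rewrite ler_pdivlMr// ltr_pdivrMr// ![_ * p 0]mulrC.
  move=> /andP[xl xr]; have xp : x < p 0 by apply: (lt_le_trans xr); rewrite ler_piMr// ltW.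
  by rewrite xp ler_pdivlMr// ltr_pdivrMr// ![_ * p 0]mulrC xl xr.
exists (p 0 + (1 - p 0) * l), (p 0 + (1 - p 0) * r); split.
- by rewrite addr_ge0 ?mulr_ge0// ltW.
- by rewrite -lerBrDl ler_piMr// ltW.
- by rewrite -rl; ring.
move=> x x01; rewrite (step _ x01) /y; split.
  by move=> [->]; rewrite ler_pdivlMr// ltr_pdivrMr// lerBrDl ltrBlDl ![_ * (1 - p 0)]mulrC.
move=> /andP[xl xr].
have xp : (x < p 0) = false by apply/negbTE; rewrite -leNgt (le_trans _ xl)// lerDl mulr_ge0// ltW.
by rewrite xp ler_pdivlMr// ltr_pdivrMr// lerBrDl ltrBlDl ![_ * (1 - p 0)]mulrC xl xr.
Qed.

Definition unif : probability (measurableTypeR R) R := uniform_prob (@ltr01 R).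

Lemma unifE (A : set R) : measurable A ->
  unif A = lebesgue_measure (A `&` [set x : R | 0 <= x <= 1]).
Proof.
move=> mA; rewrite /unif /= /uniform_prob integral_uniform_pdf.
rewrite (_ : [set x | _] = [set` `[0%R, 1%R]]); last by apply/seteqP; split => x /=; rewrite in_itv.
rewrite (eq_integral (fun=> 1%E)); last first.
  move=> x; rewrite inE /= in_itv /= => -[_ x01].
  by rewrite /uniform_pdf x01 subr0 invr1.
by rewrite integral_cst ?mul1e//; exact: measurableI.
Qed.

Lemma unif_split_bit (p : nat -> R) (b : nat -> bool) (n : nat) :
  (forall k, 0 < p k < 1) ->
  fine (unif [set x | forall k, (k < n)%N -> split_bit p k x = b k]) =
  \prod_(0 <= k < n) (if b k then p k else 1 - p k).
Proof.
move=> p01; have [l [r [l0 r1 rl H]]] := split_bit_itv b n p01.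
set E := [set x | _].
have mE : measurable E.
  rewrite (_ : E = \bigcap_(k in [set k | (k < n)%N]) (split_bit p k @^-1` [set b k])); last first.
    by apply/seteqP; split.
  apply: bigcap_measurableType => k _; rewrite -[X in measurable X]setTI.
  exact: measurable_split_bit.
have rl0 : 0 < r - l.
  rewrite rl; apply: prodr_gt0 => k _.
  by have /andP[? ?] := p01 k; case: ifP; rewrite ?subr_gt0.
have LI : lebesgue_measure [set` `[l, r[] = (r - l)%:E.
  by rewrite lebesgue_measure_itv /= lte_fin -subr_gt0 rl0.
suff -> : unif E = (r - l)%:E by [].
rewrite unifE//; apply/eqP; rewrite eq_le; apply/andP; split.
  (* The description by intervals covers [[0, 1)] only; the endpoint 1 is added as a null set. *)
  apply: (@le_trans _ _ (lebesgue_measure ([set` `[l, r[] `|` [set 1%R]))).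
    apply: le_measure; rewrite ?inE//; first by apply: measurableI => //;
       rewrite (_ : [set x | _] = [set` `[0%R, 1%R]]) //; apply/seteqP; split => x /=; rewrite in_itv.
      exact: measurableU.
    move=> x [Ex /andP[x0]]; rewrite le_eqVlt => /predU1P[->|x1]; first by right.
    by left; rewrite /= in_itv /= -H ?x0.
  apply: le_trans (measureU2 _ _ _) _ => //.
  rewrite [X in (_ + X)%E](_ : _ = 0%E); last exact: lebesgue_measure_set1.
  by rewrite adde0 [leLHS](_ : _ = (r - l)%:E) // LI.
apply: (@le_trans _ _ (lebesgue_measure [set` `[l, r[])); first by rewrite LI.
apply: le_measure; rewrite ?inE//; first by apply: measurableI => //;
  rewrite (_ : [set x | _] = [set` `[0%R, 1%R]]) //; apply/seteqP; split => x /=; rewrite in_itv.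
move=> x; rewrite /= in_itv /= => /andP[lx xr].
have x0 : 0 <= x by exact: le_trans lx.
have x1 : x < 1 by exact: lt_le_trans r1.
by split; [apply/H; rewrite ?x0 ?x1 ?lx | rewrite x0 ltW].
Qed.

End BitSplitting.

Section BlockLaw.
Context {R : realType} {N d : nat} (theta : 'I_N -> 'I_d -> R).
Hypothesis theta01 : forall a i, 0 < theta a i < 1.
Local Notation key := ('I_N * nat)%type.
Local Notation X := {ffun 'I_d -> bool}.

(* The sample [s] of arm [a] is read off the block of [d] consecutive bits
   whose rank is the code of [(a, s)]. *)
Definition bit_prob (l : nat) : R :=
  if @unpickle key (l %/ d)%N is Some k then
    if insub (l %% d)%N is Some i then theta k.1 i else 1 / 2
  else 1 / 2.

Definition block (k : nat) (x : R) : X := [ffun i : 'I_d => split_bit bit_prob (k * d + i)%N x].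
Definition block_weight (k : nat) (c : X) : R :=
  \prod_i (if c i then bit_prob (k * d + i)%N else 1 - bit_prob (k * d + i)%N).
Definition obs (k : key) : R -> X := block (pickle k).
Definition obs_weight (a : 'I_N) (c : X) : R :=
  \prod_i (if c i then theta a i else 1 - theta a i).

Lemma bit_prob01 l : 0 < bit_prob l < 1.
Proof.
have half : 0 < (1 / 2 : R) < 1 by apply/andP; split; lra.
by rewrite /bit_prob; case: unpickle => [k|//]; case: insub => [i|//].
Qed.

Lemma block_weight_pickle (k : key) c : block_weight (pickle k) c = obs_weight k.1 c.
Proof.
apply: eq_bigr => i _; have d0 : (0 < d)%N := leq_ltn_trans (leq0n i) (ltn_ord i).
suff -> : bit_prob (pickle k * d + i)%N = theta k.1 i by [].
by rewrite /bit_prob divnMDl// divn_small// addn0 pickleK modnMDl modn_small// valK.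
Qed.

Lemma obs_weight_prod a (f : 'I_d -> bool -> R) :
  \sum_(c : X) (\prod_i f i (c i)) * obs_weight a c =
  \prod_i (theta a i * f i true + (1 - theta a i) * f i false).
Proof.
pose F i b := f i b * (if b then theta a i else 1 - theta a i).
transitivity (\sum_(c : X) \prod_i F i (c i)).
  by apply: eq_bigr => c _; rewrite -big_split.
rewrite -(bigA_distr_bigA F).
by apply: eq_bigr => i _; rewrite big_bool; congr (_ + _); rewrite mulrC.
Qed.

Lemma obs_weight_coord a i (h : bool -> R) :
  \sum_(c : X) h (c i) * obs_weight a c = theta a i * h true + (1 - theta a i) * h false.
Proof.
rewrite -[RHS](_ : \prod_j (theta a j * (if j == i then h true else 1) +
   (1 - theta a j) * (if j == i then h false else 1)) = _).
  rewrite -(obs_weight_prod a (fun j b => if j == i then h b else 1)).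
  apply: eq_bigr => c _; congr (_ * _).
  by rewrite -big_mkcond big_pred1_eq.
rewrite (bigD1 i)//= eqxx big1 ?mulr1// => j /negbTE ->.
by rewrite !mulr1 addrC subrK.
Qed.

Lemma sum_obs_weight a : \sum_c obs_weight a c = 1.
Proof.
have := obs_weight_prod a (fun _ _ => 1).
rewrite (eq_bigr (obs_weight a)) => [->|c _]; last by rewrite big1 ?mul1r.
by rewrite big1// => i _; rewrite !mulr1 addrC subrK.
Qed.

Lemma sum_block_weight k : \sum_c block_weight k c = 1.
Proof.
rewrite /block_weight -(bigA_distr_bigA
  (fun (i : 'I_d) (b : bool) => if b then bit_prob (k * d + i)%N else 1 - bit_prob (k * d + i)%N)).
by rewrite big1// => i _; rewrite big_bool /= addrC subrK.
Qed.

Lemma obs_weight_ge0 a c : 0 <= obs_weight a c.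
Proof.
apply: prodr_ge0 => i _; have /andP[t0 t1] := theta01 a i.
by case: ifP; rewrite ?subr_ge0 ltW.
Qed.

Lemma unif_blocks n (c : nat -> X) :
  fine (unif [set x : R | forall k, (k < n)%N -> block k x = c k]) =
  \prod_(0 <= k < n) block_weight k (c k).
Proof.
pose b l := if insub (l %% d)%N is Some i then c (l %/ d)%N i else false.
rewrite (_ : [set x | _] = [set x | forall l, (l < n * d)%N -> split_bit bit_prob l x = b l]).
  rewrite unif_split_bit; last exact: bit_prob01.
  rewrite big_nat_mul; apply: eq_big_nat => k /andP[_ kn].
  rewrite -{1}[(k * d)%N]add0n big_addn mulSn addnK big_mkord; apply: eq_bigr => i _.
  have d0 : (0 < d)%N := leq_ltn_trans (leq0n i) (ltn_ord i).
  by rewrite /b addnC modnMDl divnMDl// divn_small// modn_small// valK addn0.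
apply/seteqP; split=> x Hx.
  move=> l ln; have d0 : (0 < d)%N by case: (d) ln => //; rewrite muln0.
  have ld : (l %/ d < n)%N by rewrite ltn_divLR.
  have /ffunP /(_ (Ordinal (ltn_pmod l d0))) := Hx _ ld.
  rewrite ffunE /= -divn_eq => ->; rewrite /b.
  by rewrite (insubT (fun x => x < d)%N (ltn_pmod l d0)).
move=> k kn; apply/ffunP => i; rewrite ffunE Hx.
  have d0 : (0 < d)%N := leq_ltn_trans (leq0n i) (ltn_ord i).
  by rewrite /b modnMDl divnMDl// divn_small// modn_small// valK addn0.
by apply: (@leq_trans (k.+1 * d)%N); rewrite ?leq_mul2r ?kn ?orbT// mulSn addnC ltn_add2r.
Qed.

Lemma measurable_block k c : measurable (block k @^-1` [set c]).
Proof.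
rewrite (_ : _ @^-1` _ = \bigcap_(i in [set: 'I_d])
    (split_bit bit_prob (k * d + i)%N @^-1` [set c i])).
  apply: fin_bigcap_measurable => // i _; rewrite -[X in measurable X]setTI.
  exact: measurable_split_bit.
apply/seteqP; split=> [x /= <- i _|x /= H]; first by rewrite /= ffunE.
by apply/ffunP => i; rewrite ffunE; exact: H.
Qed.

Lemma unif_blocks_pred n (C : nat -> pred X) :
  fine (unif [set x : R | forall k, (k < n)%N -> C k (block k x)]) =
  \prod_(0 <= k < n) \sum_(c | C k c) block_weight k c.
Proof.
pose g (x : R) := [ffun k : 'I_n => block k x].
have gE (f : {ffun 'I_n -> X}) : g @^-1` [set f] =
    [set x : R | forall k, (k < n)%N -> block k x = if insub k is Some k' then f k' else [ffun=> false]].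
  apply/seteqP; split=> [x /= <- k kn|x /= H].
    by rewrite insubT ffunE.
  by apply/ffunP => k; rewrite ffunE H// valK.
have mg f : measurable (g @^-1` [set f]).
  rewrite (_ : _ @^-1` _ = \bigcap_(k in [set: 'I_n]) (block k @^-1` [set f k])).
    by apply: fin_bigcap_measurable => // k _; exact: measurable_block.
  apply/seteqP; split=> [x /= <- k _|x /= H]; first by rewrite /= ffunE.
  by apply/ffunP => i; rewrite ffunE; exact: H.
rewrite (_ : [set x | _] = g @^-1` [set f | [forall k : 'I_n, C k (f k)]]); last first.
  apply/seteqP; split=> x /= H.
    by apply/forallP => k; rewrite ffunE H.
  by move=> k kn; have /forallP/(_ (Ordinal kn)) := H; rewrite ffunE.
rewrite (probability_fin_preimage unif mg) big_mkord.
rewrite (bigA_distr_big_dep (fun k : 'I_n => C k)).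
apply: eq_big => [f|f _]; first by apply/forallP/familyP.
 rewrite gE unif_blocks big_mkord.
by apply: eq_bigr => k _; rewrite valK.
Qed.

Lemma unif_obs (S : seq key) (C : key -> pred X) : uniq S ->
  fine (unif [set x : R | forall k, k \in S -> C k (obs k x)]) =
  \prod_(k <- S) \sum_(c | C k c) obs_weight k.1 c.
Proof.
move=> uS; pose n := (\max_(k <- S) pickle k)%N.+1.
have Sn k : k \in S -> (pickle k < n)%N by move=> kS; rewrite ltnS; exact: leq_bigmax_seq.
(* Ranks below [n] that code no key of [S] get a trivial constraint; their block weights sum to 1
   and drop out of the product. *)
pose C' (k : nat) (c : X) := if @pickle_inv key k is Some κ then (κ \in S) ==> C κ c else true.
rewrite (_ : [set x | _] = [set x | forall k, (k < n)%N -> C' k (block k x)]); last first.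
  apply/seteqP; split=> x /= H k.
    move=> kn; rewrite /C'; have := @pickle_invK key k; case: pickle_inv => //= κ kE.
    by apply/implyP => κS; rewrite -kE; exact: H.
  by move=> kS; have := H _ (Sn _ kS); rewrite /C' pickleK_inv kS.
rewrite unif_blocks_pred.
rewrite (bigID (fun k => k \in map pickle S)) /= [X in _ * X]big1 ?mulr1; last first.
  move=> k kS; rewrite -[RHS](sum_block_weight k); apply: eq_bigl => c.
  rewrite /C'; have := @pickle_invK key k; case: pickle_inv => //= κ kE.
  by case: (boolP (κ \in S)) => // κS; rewrite -kE map_f in kS.
rewrite -big_filter.
have -> : \prod_(k <- S) \sum_(c | C k c) obs_weight k.1 c =
    \prod_(k <- map pickle S) \sum_(c | C' k c) block_weight k c.
  rewrite big_map !big_seq; apply: eq_bigr => k kS.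
  rewrite /C' pickleK_inv; apply: eq_big => [c|c _]; first by rewrite kS.
  by rewrite block_weight_pickle.
apply: perm_big; apply: uniq_perm.
- by rewrite filter_uniq// iota_uniq.
- by rewrite map_inj_uniq//; exact: (pcan_inj pickleK).
move=> k; rewrite mem_filter mem_index_iota /=; case: (boolP (k \in _)) => //= /mapP[κ κS ->].
exact: Sn.
Qed.

End BlockLaw.

(** * Two-point environments *)

Section Environments.
Context {R : realType} {N d : nat} (theta : 'I_N -> 'I_d -> R) (off : 'I_N -> R) (B : R).
Hypothesis theta01 : forall a i, 0 < theta a i < 1.
Local Notation key := ('I_N * nat)%type.
Local Notation X := {ffun 'I_d -> bool}.
Local Notation Omega := (measurableTypeR R * measurableTypeR R)%type.

(** The first factor carries the external randomness and the second all stacks of samples, which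
    makes the two independent by construction. *)
Definition unif2 : probability Omega R := (unif \x unif)%E.
Definition env_U (w : Omega) : R := w.1.
Definition env_obs (k : key) (w : Omega) : X := obs theta k w.2.
Definition observation (a : 'I_N) (c : X) : d.-tuple R :=
  [tuple off a + B * (c i)%:R | i < d].
Definition env_Y (a : 'I_N) (s : nat) (w : Omega) : d.-tuple R :=
  observation a (env_obs (a, s) w).

Lemma measurable_env_U : measurable_fun setT env_U.
Proof. exact: measurable_fst. Qed.

Lemma measurable_env_obs k c : measurable (env_obs k @^-1` [set c]).
Proof.
rewrite (_ : _ @^-1` _ = setT `*` (obs theta k @^-1` [set c])).
  by apply: measurableX => //; exact: measurable_block.
by apply/seteqP; split => [w|w []].
Qed.

Lemma probability_env_obs (A : set R) (S : seq key) (C : key -> pred X) :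
  measurable A -> uniq S ->
  fine (unif2 [set w | A (env_U w) /\ forall k, k \in S -> C k (env_obs k w)]) =
  fine (unif A) * \prod_(k <- S) \sum_(c | C k c) obs_weight theta k.1 c.
Proof.
move=> mA uS; rewrite -(unif_obs theta01)//.
set E := [set x : R | _].
have mE : measurable E.
  rewrite (_ : E = \bigcap_(k in [set` S]) (obs theta k @^-1` [set c | C k c])).
    apply: fin_bigcap_measurable => // k _; apply: measurable_fin_preimage.
    exact: measurable_block.
  by apply/seteqP; split.
rewrite (_ : [set w | _] = A `*` E); last by apply/seteqP; split.
have -> : unif2 (A `*` E) = (unif A * unif E)%E by exact: product_measure1E.
by rewrite fineM// fin_num_measure.
Qed.

Lemma env_obs_law k (C : pred X) :
  fine (unif2 (env_obs k @^-1` [set c | C c])) = \sum_(c | C c) obs_weight theta k.1 c.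
Proof.
have := probability_env_obs (A := setT) (S := [:: k]) (fun=> C) measurableT isT.
rewrite probability_setT mul1r big_seq1 => <-; congr (fine (unif2 _)).
apply/seteqP; split=> w /=; first by move=> Cw; split => // k'; rewrite inE => /eqP ->.
by move=> [_]; apply; rewrite inE.
Qed.

Lemma env_obs_law1 k c : fine (unif2 (env_obs k @^-1` [set c])) = obs_weight theta k.1 c.
Proof.
have := env_obs_law k (pred1 c); rewrite big_pred1_eq => <-; congr (fine (unif2 (_ @^-1` _))).
by apply/seteqP; split => c' /= /eqP.
Qed.

Lemma env_Y_law a s (Q : set (d.-tuple R)) :
  fine (unif2 (env_Y a s @^-1` Q)) =
  \sum_(c | `[< Q (observation a c) >]) obs_weight theta a c.
Proof.
rewrite -(env_obs_law (a, s)); congr (fine (unif2 _)).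
by apply/seteqP; split=> w /= /asboolP.
Qed.

Lemma measurable_env_Y a s : measurable_fun setT (env_Y a s).
Proof. exact: (measurable_fin_comp (measurable_env_obs (a, s)) (observation a)). Qed.

Lemma realization_env : realization unif2 env_U env_Y.
Proof.
have mY a s (Q : set (d.-tuple R)) : measurable (env_Y a s @^-1` Q).
  exact: (measurable_fin_preimage (measurable_env_obs (a, s)) (observation a @^-1` Q)).
split.
- exact: measurable_env_U.
- exact: measurable_env_Y.
- move=> A mA; rewrite -unifE// -[LHS]fineK ?fin_num_measure//; last first.
    by rewrite -[X in measurable X]setTI; exact: measurable_env_U.
  have := probability_env_obs (S := [::]) (fun _ _ => true) mA isT.
  rewrite big_nil mulr1 => e; rewrite -[RHS]fineK ?fin_num_measure// -e.
  congr (fine (unif2 _))%:E.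
  by apply/seteqP; split=> w //= [].
- move=> a s Q _.
  have E s' : unif2 (env_Y a s' @^-1` Q) =
      (\sum_(c | `[< Q (observation a c) >]) obs_weight theta a c)%:E.
    by rewrite -(env_Y_law a s') fineK// fin_num_measure.
  by rewrite !E.
- move=> S A Q uS mA mQ.
  pose C (k : key) (c : X) := `[< Q k.1 k.2 (observation k.1 c) >].
  rewrite (_ : _ `&` _ = [set w | A (env_U w) /\ forall k, k \in S -> C k (env_obs k w)]).
    transitivity (fine (unif A) * \prod_(k <- S) \sum_(c | C k c) obs_weight theta k.1 c).
      exact: probability_env_obs.
    congr (_ * _).
      have := probability_env_obs (S := [::]) (fun _ _ => true) mA isT.
      rewrite big_nil mulr1 => <-; congr (fine (unif2 _)).
      by apply/seteqP; split=> w //= [].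
    by apply: eq_bigr => k _; rewrite env_Y_law.
  apply/seteqP; split=> w /= [Aw H]; split=> // k kS.
    by apply/asboolP; have := H k kS; rewrite /= /env_Y; case: k {kS}.
  by have /asboolP := H k kS; rewrite /= /env_Y; case: k {kS}.
Qed.

Lemma env_coord_law a s i (Q : set bool) :
  fine (unif2 [set w | Q (env_obs (a, s) w i)]) =
  theta a i * `[< Q true >]%:R + (1 - theta a i) * `[< Q false >]%:R.
Proof.
rewrite -(obs_weight_coord theta a i (fun b => `[< Q b >]%:R)).
rewrite (_ : [set w | _] = env_obs (a, s) @^-1` [set c | `[< Q (c i) >]]); last first.
  by apply/seteqP; split=> w /= /asboolP.
rewrite env_obs_law /= big_mkcond; apply: eq_bigr => c _.
by case: asboolP; rewrite ?mul1r ?mul0r.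
Qed.

Definition env_mean (a : 'I_N) : 'cV[R]_d := \col_i (off a + B * theta a i).

Lemma arm_mean_env a : arm_mean unif2 env_Y a (env_mean a).
Proof.
move=> i; have mo := measurable_env_obs (a, 0%N).
pose f (c : X) := off a + B * (c i)%:R.
have -> : (fun w => (tnth (env_Y a 0 w) i)%:E) = (fun w => (f (env_obs (a, 0%N) w))%:E).
  by apply/funext => w; rewrite tnth_mktuple.
split; first exact: (integrable_fin_comp unif2 mo f).
rewrite (integral_fin_comp unif2 mo f); congr (_%:E).
under eq_bigr => c _ do rewrite env_obs_law1.
by rewrite (obs_weight_coord theta a i (fun b => off a + B * b%:R)) mxE /=; ring.
Qed.

Lemma arm_subgaussian_env sigma a : 0 < sigma ->
  (forall i t, theta a i * expR (t * (B / sigma * (1 - theta a i))) +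
     (1 - theta a i) * expR (t * (B / sigma * (0 - theta a i))) <= expR (t ^+ 2 / 2)) ->
  arm_subgaussian unif2 env_Y sigma a (env_mean a).
Proof.
(* An isotropic proxy [sigma ^+ 2] times the identity: the standardized coordinates are centred bits
   scaled by [B / sigma]. *)
move=> s0 Hmgf; exists (sigma ^+ 2)%:M, sigma%:M.
have Smx (r : R) (v : 'cV[R]_d) : r%:M *m v = r *: v by rewrite mul_scalar_mx.
split.
- by rewrite tr_scalar_mx.
- move=> x; rewrite Smx /vnorm.
  under eq_bigr => i _ do rewrite mxE exprMn.
  by rewrite -mulr_sumr sqrtrM ?sqr_ge0// sqrtr_sqr ger0_norm// sqr_ge0.
- split; first by rewrite tr_scalar_mx.
  move=> x x0; rewrite -mulmxA Smx mxE; under eq_bigr => i _ do rewrite !mxE mulrCA.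
  rewrite -mulr_sumr mulr_gt0//.
  have [i xi] : exists i, x i 0 != 0.
    apply/existsP; apply: contraNT x0; rewrite negb_exists => /forallP x0.
    by apply/eqP/matrixP => i j; rewrite ord1 mxE; apply/eqP; have := x0 i; rewrite negbK.
  rewrite (bigD1 i)//= ltr_pwDl//; first by rewrite -expr2 lt_def sqr_ge0 sqrf_eq0 xi.
  by apply: sumr_ge0 => j _; rewrite -expr2 sqr_ge0.
- by rewrite -scalar_mxM expr2.
move=> E.
have EE w i : E w i 0 = B / sigma * ((env_obs (a, 0%N) w i)%:R - theta a i).
  by rewrite /E invmx_scalar Smx !mxE tnth_mktuple; field; exact: lt0r_neq0.
pose z i (b : bool) := B / sigma * (b%:R - theta a i).
split.
  move=> Q mQ.
  rewrite (_ : \bigcap_i _ = env_obs (a, 0%N) @^-1` [set c | [forall i, `[< Q i (z i (c i)) >]]]); last first.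
    apply/seteqP; split=> w /=.
      by move=> H; apply/forallP => i; apply/asboolP; rewrite /z -EE; exact: H.
    by move=> /forallP H i _; have /asboolP := H i; rewrite /z -EE.
  rewrite env_obs_law /=.
  transitivity (\prod_i (theta a i * `[< Q i (z i true) >]%:R +
    (1 - theta a i) * `[< Q i (z i false) >]%:R)).
    rewrite -(obs_weight_prod theta a (fun i b => `[< Q i (z i b) >]%:R)) big_mkcond.
    apply: eq_bigr => c _; case: ifPn => [/forallP H|].
      by rewrite big1 ?mul1r// => i _; rewrite H.
    by move=> /forallPn[i /negbTE Hi]; rewrite (bigD1 i)//= Hi !mul0r.
  apply: eq_bigr => i _; rewrite -(env_coord_law a 0 i (fun b => Q i (z i b))).
  by congr (fine (unif2 _)); apply/seteqP; split=> w /=; rewrite /z EE.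
move=> i t.
pose f (c : X) := expR (t * z i (c i)).
have -> : (fun w => (expR (t * E w i 0))%:E) = (fun w => (f (env_obs (a, 0%N) w))%:E).
  by apply/funext => w; rewrite EE.
rewrite (integral_fin_comp unif2 (measurable_env_obs (a, 0%N)) f) lee_fin.
under eq_bigr => c _ do rewrite env_obs_law1.
rewrite (obs_weight_coord theta a i (fun b => expR (t * z i b))).
exact: Hmgf.
Qed.

End Environments.

(** * Law of the history of a strategy *)

#[local] Arguments st_arm {R N K d}.
#[local] Arguments st_stop {R N K d}.
#[local] Arguments st_rec {R N K d}.
#[local] Arguments st_arm_meas {R N K d}.

Lemma tuple_fun_eq (E A : Type) (f : forall t, t.-tuple E -> A) t t' (u : t.-tuple E) (u' : t'.-tuple E) :
  tval u = tval u' -> f t u = f t' u'.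
Proof.
move=> uu; have tt : t = t' by rewrite -(size_tuple u) uu size_tuple.
by subst t'; congr (f t _); apply: val_inj.
Qed.

(** Read off the definition of the integral as a supremum over simple functions lying below. It
    serves for [tau], whose measurability is not established here. *)
Lemma ge0_le_integral_nonmeas {R : realType} d (T : measurableType d)
    (mu : {measure set T -> \bar R}) (f g : T -> \bar R) :
  (forall x, 0 <= f x)%E -> (forall x, f x <= g x)%E ->
  (\int[mu]_x f x <= \int[mu]_x g x)%E.
Proof.
move=> f0 fg; have g0 x : (0 <= g x)%E by exact: le_trans (fg x).
rewrite !ge0_integralTE//; apply: ereal_sup_le => _ [h hf <-].
by exists h => // x; exact: le_trans (fg x).
Qed.

Lemma uniq_map_inj (S T : eqType) (f : S -> T) (s : seq S) :
  uniq (map f s) -> {in s &, injective f}.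
Proof.
elim: s => // x s IH /= /andP[fx us] y z; rewrite !inE => /predU1P[->|ys] /predU1P[->|zs] // fyz.
- by rewrite fyz map_f in fx.
- by rewrite -fyz map_f in fx.
- exact: IH.
Qed.

Section Histories.
Context {A X : finType}.
Local Notation T := (A * X)%type.

Fixpoint keys_from (pre h : seq T) : seq ((A * nat) * X) :=
  if h is e :: h' then
    ((e.1, count (fun e' : T => e'.1 == e.1) pre), e.2) :: keys_from (rcons pre e) h'
  else [::].

(* The positions [(a, s)] of the stacks of samples that are read along a history,
   together with the values found there. *)
Definition keys := keys_from [::].

Lemma keys_rcons h e :
  keys (rcons h e) = rcons (keys h) ((e.1, count (fun e' : T => e'.1 == e.1) h), e.2).
Proof.
suff H pre : keys_from pre (rcons h e) =
    rcons (keys_from pre h) ((e.1, count (fun e' : T => e'.1 == e.1) (pre ++ h)), e.2) by exact: H.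
elim: h pre => [|e' h IH] pre /=; first by rewrite cats0.
by rewrite IH cat_rcons.
Qed.

Lemma keys_lt h k : k \in keys h -> (k.1.2 < count (fun e => e.1 == k.1.1) h)%N.
Proof.
elim/last_ind: h => // h e IH; rewrite keys_rcons mem_rcons inE -cats1 count_cat /= addn0.
case/predU1P => [-> /=|/IH kh]; first by rewrite eqxx addn1.
exact: leq_trans (leq_addr _ _).
Qed.

(** No position of a stack is read twice, because the index read is the number of earlier pulls of
    the same arm. This is what allows independence to be applied along an adaptive history. *)
Lemma uniq_keys h : uniq (map fst (keys h)).
Proof.
elim/last_ind: h => // h e IH; rewrite keys_rcons map_rcons rcons_uniq IH andbT.
by apply/negP => /mapP[k /keys_lt + ke]; rewrite -ke /= ltnn.
Qed.

Lemma big_keys (R : comPzRingType) h (f : A -> X -> R) :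
  \prod_(k <- keys h) f k.1.1 k.2 = \prod_(e <- h) f e.1 e.2.
Proof.
elim/last_ind: h => [|h e IH]; first by rewrite !big_nil.
by rewrite keys_rcons -!cats1 !big_cat /= !big_seq1 IH.
Qed.

Fixpoint follows_from (next : seq T -> A) (pre h : seq T) : bool :=
  if h is e :: h' then (next pre == e.1) && follows_from next (rcons pre e) h' else true.

Definition follows next := follows_from next [::].

Lemma follows_rcons next h e : follows next (rcons h e) = follows next h && (next h == e.1).
Proof.
suff H pre : follows_from next pre (rcons h e) =
    follows_from next pre h && (next (pre ++ h) == e.1) by exact: H.
elim: h pre => [|e' h IH] pre /=; first by rewrite cats0 andbT.
by rewrite IH cat_rcons andbA.
Qed.

End Histories.

Section Process.
Context {R : realType} {N K d : nat} (pi : strategy R N K d) (off : 'I_N -> R) (B : R).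
Local Notation X := {ffun 'I_d -> bool}.
Local Notation T := ('I_N * X)%type.
Local Notation Omega := (measurableTypeR R * measurableTypeR R)%type.

Definition emb (e : T) : hist_elem R d := (nat_of_ord e.1, observation off B e.1 e.2).
Definition emb_hist (h : seq T) : (size h).-tuple (hist_elem R d) := map_tuple emb (in_tuple h).
Definition fstop (h : seq T) : bool := st_stop pi (size h) (emb_hist h).
Definition farm (u : R) (h : seq T) : 'I_N := st_arm pi (size h) (u, emb_hist h).
Definition frec (h : seq T) : {ffun 'I_N -> 'I_K} := st_rec pi (size h) (emb_hist h).

(* The factor of the probability of [h] that is due to the strategy; it does not depend on
   the environment and cancels in likelihood ratios. *)
Definition alpha_set (h : seq T) : set R := [set u | follows (farm u) h].
Definition alpha (h : seq T) : R := fine (unif (alpha_set h)).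
Definition alphaS (h : seq T) (a : 'I_N) : R :=
  fine (unif (alpha_set h `&` [set u | farm u h = a])).

Lemma measurable_farm h a : measurable [set u | farm u h = a].
Proof.
have := st_arm_meas pi (size h) a => mA.
rewrite (_ : [set u | _] = (fun u => (u, emb_hist h)) @^-1` (st_arm pi (size h) @^-1` [set a])) //.
rewrite -[X in measurable X]setTI; exact: (pair2_measurable (emb_hist h)).
Qed.

Lemma measurable_alpha_set h : measurable (alpha_set h).
Proof.
elim/last_ind: h => [|h e IH]; first by rewrite (_ : alpha_set _ = setT)//; apply/seteqP; split.
rewrite (_ : alpha_set _ = alpha_set h `&` [set u | farm u h = e.1]).
  by apply: measurableI => //; exact: measurable_farm.
apply/seteqP; split=> u; rewrite /alpha_set /= follows_rcons.
  by case/andP=> ? /eqP.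
by case=> -> /eqP.
Qed.

Lemma alpha_ge0 h : 0 <= alpha h.
Proof. by rewrite fine_ge0. Qed.

Lemma alphaS_ge0 h a : 0 <= alphaS h a.
Proof. by rewrite fine_ge0. Qed.

Lemma alpha_nil : alpha [::] = 1.
Proof.
rewrite /alpha (_ : alpha_set _ = setT); first by rewrite probability_setT.
by apply/seteqP; split.
Qed.

Lemma alpha_rcons h a x : alpha (rcons h (a, x)) = alphaS h a.
Proof.
congr (fine (unif _)); apply/seteqP; split=> u; rewrite /alpha_set /= follows_rcons.
  by case/andP=> ? /eqP.
by case=> -> /eqP.
Qed.

Lemma alpha_sum h : \sum_a alphaS h a = alpha h.
Proof.
pose g (u : measurableTypeR R) : option 'I_N := if follows (farm u) h then Some (farm u h) else None.
have mg c : measurable (g @^-1` [set c]).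
  have mSome a : measurable (alpha_set h `&` [set u | farm u h = a]).
    by apply: measurableI; [exact: measurable_alpha_set|exact: measurable_farm].
  case: c => [a|].
    rewrite (_ : g @^-1` [set Some a] = alpha_set h `&` [set u | farm u h = a]); first exact: mSome.
    apply/seteqP; split=> u; rewrite /g /alpha_set /=.
      by case: ifP => // hu [].
    by case=> -> ->.
  rewrite (_ : g @^-1` [set None] = ~` alpha_set h).
    by apply: measurableC; exact: measurable_alpha_set.
  by apply/seteqP; split=> u; rewrite /g /alpha_set /=; case: ifP.
have := probability_fin_preimage unif mg (fun c => c != None).
rewrite (_ : g @^-1` [set c | c != None] = alpha_set h); last first.
  by apply/seteqP; split=> u; rewrite /g /alpha_set /=; case: ifP.
rewrite -/(alpha h) => ->; rewrite (reindex_omap Some id) => [|[]//]; apply: eq_big => [a|a _].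
  by rewrite /= eqxx.
congr (fine (unif _)); apply/seteqP; split=> u; rewrite /g /alpha_set /=.
  by case=> -> ->.
by case: ifP => // hu [].
Qed.

Section Law.
Context (theta : 'I_N -> 'I_d -> R).
Hypothesis theta01 : forall a i, 0 < theta a i < 1.
Local Notation Y := (env_Y theta off B).
Local Notation U := (@env_U R).
Local Notation P := (@unif2 R).

(** The finite-alphabet copy of [hist], recording bit vectors instead of real observations; [emb]
    recovers the actual history. *)
Fixpoint fhist (t : nat) (w : Omega) : seq T :=
  if t is t'.+1 then
    let h := fhist t' w in let a := farm (U w) h in
    rcons h (a, env_obs theta (a, count (fun e : T => e.1 == a) h) w)
  else [::].

Lemma size_fhist t w : size (fhist t w) = t.
Proof. by elim: t => //= t IH; rewrite size_rcons IH. Qed.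

Lemma take_fhist k t w : (k <= t)%N -> take k (fhist t w) = fhist k w.
Proof.
elim: t => [|t IH]; first by rewrite leqn0 => /eqP ->.
rewrite leq_eqVlt => /predU1P[->|kt].
  by rewrite take_oversize // size_fhist.
by rewrite /= -cats1 takel_cat ?IH// size_fhist.
Qed.

Lemma hist_fhist t w : tval (hist pi U Y t w) = map emb (fhist t w).
Proof.
elim: t => //= t IH; rewrite map_rcons.
have -> : st_arm pi t (U w, hist pi U Y t w) = farm (U w) (fhist t w).
  by apply: (tuple_fun_eq (fun t u => st_arm pi t (U w, u))).
congr rcons; first exact: IH.
rewrite /emb /= /env_Y; congr (_, observation _ _ _ (env_obs _ (_, _) _)).
by rewrite IH count_map.
Qed.

Lemma stop_fhist t w : st_stop pi t (hist pi U Y t w) = fstop (fhist t w).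
Proof. by apply: (tuple_fun_eq (st_stop pi)); rewrite hist_fhist. Qed.

Lemma rec_fhist t w : st_rec pi t (hist pi U Y t w) = frec (fhist t w).
Proof. by apply: (tuple_fun_eq (st_rec pi)); rewrite hist_fhist. Qed.

Definition hist_weight (h : seq T) : R := \prod_(e <- h) obs_weight theta e.1 e.2.

Lemma fhist_eqE h w : (fhist (size h) w == h) =
  follows (farm (U w)) h && all (fun k => env_obs theta k.1 w == k.2) (keys h).
Proof.
elim/last_ind: h => [|h [a x] IH]; first by rewrite /= eqxx.
rewrite size_rcons /= eqseq_rcons IH follows_rcons keys_rcons all_rcons /=.
case: (boolP (fhist (size h) w == h)) => [/eqP hh|nh]; last first.
  by move: nh; rewrite IH /= negb_and => /orP[/negbTE -> //|/negbTE ->]; rewrite !andbF.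
move: IH; rewrite hh eqxx => /esym /andP[-> ->] /=; rewrite andbT xpair_eqE.
by case: eqP => //= ->.
Qed.

(** The process follows [h] exactly when [U] lies in [alpha_set h] and the stack positions read
    along [h] contain the recorded values. These are finitely many independent constraints at
    distinct positions. *)
Lemma fhist_law h :
  fine (P [set w | fhist (size h) w = h]) = alpha h * hist_weight h.
Proof.
pose C (k : 'I_N * nat) (c : X) := all (fun p => (p.1 == k) ==> (c == p.2)) (keys h).
have -> : [set w | fhist (size h) w = h] = [set w | alpha_set h (U w) /\
     forall k, k \in map fst (keys h) -> C k (env_obs theta k w)].
  apply/seteqP; split=> w /=.
    move=> /eqP; rewrite fhist_eqE => /andP[fw /allP kw]; split => // k _.
    by apply/allP => p /kw /eqP pk; apply/implyP => /eqP <-; rewrite pk.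
  case=> fw kw; apply/eqP; rewrite fhist_eqE fw /=; apply/allP => p ph.
  have /allP/(_ _ ph) := kw _ (map_f _ ph); by rewrite eqxx.
rewrite (probability_env_obs theta01)//; [|exact: measurable_alpha_set|exact: uniq_keys].
congr (_ * _); rewrite big_map /hist_weight -(big_keys h (obs_weight theta)) !big_seq.
apply: eq_bigr => p ph; rewrite (big_pred1 p.2)// => c; rewrite /C /=.
apply/allP/eqP => [/(_ _ ph)|-> q qh]; first by rewrite eqxx => /eqP.
by apply/implyP => /eqP /(uniq_map_inj (uniq_keys h) qh ph) ->.
Qed.

Lemma measurable_fhist h : measurable [set w | fhist (size h) w = h].
Proof.
rewrite (_ : [set w | _] = (U @^-1` alpha_set h) `&`
    \bigcap_(k in [set` keys h]) (env_obs theta k.1 @^-1` [set k.2])).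
  apply: measurableI.
    by rewrite -[X in measurable X]setTI; apply: measurable_env_U => //; exact: measurable_alpha_set.
  apply: fin_bigcap_measurable => // k _; exact: measurable_env_obs.
apply/seteqP; split=> w /=.
  by move=> /eqP; rewrite fhist_eqE => /andP[fw /allP kw]; split => // k /= /kw /eqP.
case=> fw kw; apply/eqP; rewrite fhist_eqE; apply/andP; split => //.
by apply/allP => k kh; apply/eqP; exact: kw.
Qed.

Definition hist_prob (h : seq T) : R := alpha h * hist_weight h.

Lemma sum_hist_prob h : \sum_(e : T) hist_prob (rcons h e) = hist_prob h.
Proof.
pose f a x := alphaS h a * hist_weight h * obs_weight theta a x.
rewrite (eq_bigr (fun e : T => f e.1 e.2)) => [|[a x] _]; last first.
  by rewrite /hist_prob alpha_rcons /hist_weight -cats1 big_cat big_seq1 mulrA.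
rewrite -(pair_bigA _ f) /hist_prob -alpha_sum mulr_suml; apply: eq_bigr => a _.
by rewrite -mulr_sumr sum_obs_weight mulr1.
Qed.

Lemma integral_stopped_prefix n (G : seq T -> R) :
  (\int[P]_w (G (stopped_prefix fstop [::] (fhist n w)))%:E =
   (stopped_sum fstop n (fun h => hist_prob h * G h) [::])%:E)%E.
Proof.
pose g (w : Omega) : n.-tuple T := tcast (size_fhist n w) (in_tuple (fhist n w)).
have gE w : tval (g w) = fhist n w by rewrite val_tcast.
have gfib (r : n.-tuple T) : g @^-1` [set r] = [set w | fhist (size r) w = r].
  rewrite size_tuple; apply/seteqP; split=> w /=; first by move=> <-; rewrite gE.
  by move=> wr; apply: val_inj; rewrite /= gE.
have mg r : measurable (g @^-1` [set r]) by rewrite gfib; exact: measurable_fhist.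
pose f (r : n.-tuple T) := G (stopped_prefix fstop [::] r).
transitivity (\int[P]_w (f (g w))%:E)%E.
  by apply: eq_integral => w _; rewrite /f gE.
rewrite (integral_fin_comp P mg); congr (_%:E).
rewrite -(sum_stopped_prefix fstop G n [::] sum_hist_prob); apply: eq_bigr => r _.
by rewrite gfib fhist_law.
Qed.

Lemma stopped_fhistP n w : exists k, [/\ (k <= n)%N,
  stopped_prefix fstop [::] (fhist n w) = fhist k w,
  forall j, (j < k)%N -> ~~ fstop (fhist j w) &
  fstop (fhist k w) || (k == n)].
Proof.
have [k [kn -> nst st]] := stopped_prefixP fstop [::] (fhist n w).
rewrite size_fhist in kn st; exists k; split => //; [exact: take_fhist| |by rewrite -(take_fhist w kn)].
move=> j jk; by rewrite -(take_fhist w (leq_trans (ltnW jk) kn)); exact: nst.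
Qed.

Definition fok (G : {ffun 'I_N -> 'I_K}) (h : seq T) : bool := `[< part_equiv G (frec h) >].

Lemma stopped_sum_prob n : stopped_sum fstop n (fun h => hist_prob h * 1) [::] = 1.
Proof.
transitivity (stopped_sum fstop n hist_prob [::]).
  by apply: eq_stopped_sum => h; rewrite mulr1.
rewrite stopped_sum_martingale; last exact: sum_hist_prob.
by rewrite /hist_prob alpha_nil /hist_weight big_nil mulr1.
Qed.

Lemma measurable_fhist_pred n (Q : set (seq T)) : measurable [set w | Q (fhist n w)].
Proof.
rewrite (_ : [set w | _] = \bigcup_(r in [set r : n.-tuple T | Q r]) [set w | fhist (size r) w = r]).
  by apply: fin_bigcup_measurable => // r _; exact: measurable_fhist.
apply/seteqP; split=> w /=.
  move=> Qw; exists (tcast (size_fhist n w) (in_tuple (fhist n w))) => /=.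
    by rewrite val_tcast.
  by rewrite val_tcast /= (size_fhist n w).
by move=> [r Qr]; rewrite /= size_tuple => ->.
Qed.

(** Truncation can only help: a run that is correct in the end has either not stopped within [n]
    rounds or stopped within them with a correct answer. Runs that have not stopped are therefore
    counted as correct. *)
Lemma probability_correct_le n G :
  (P (correct pi U Y G) <=
   (stopped_sum fstop n (fun h => hist_prob h * (~~ fstop h || fok G h)%:R) [::])%:E)%E.
Proof.
rewrite -integral_stopped_prefix.
set f := (fun h => (~~ fstop h || fok G h)%:R : R).
pose E := [set w | ~~ fstop (stopped_prefix fstop [::] (fhist n w)) ||
                   fok G (stopped_prefix fstop [::] (fhist n w))].
have mE : measurable E.
  exact: (measurable_fhist_pred n (fun r => ~~ fstop (stopped_prefix fstop [::] r) ||
                   fok G (stopped_prefix fstop [::] r))).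
rewrite (eq_integral (fun w => (\1_E w)%:E)) => [|w _]; last first.
  rewrite indicE /f.
  suff -> : (w \in E) = (~~ fstop (stopped_prefix fstop [::] (fhist n w)) ||
     fok G (stopped_prefix fstop [::] (fhist n w))) by [].
  by apply/idP/idP; rewrite in_setE.
rewrite integral_indic// setIT; apply: le_measure; rewrite ?inE//.
  rewrite (_ : correct pi U Y G = \bigcup_(t in setT) (\bigcap_(t' in [set t' | (t' < t)%N])
     [set w | ~~ fstop (fhist t' w)] `&` [set w | fstop (fhist t w) /\ part_equiv G (frec (fhist t w))])).
    apply: bigcupT_measurable => t; apply: measurableI.
      by apply: bigcap_measurableType => t' _; exact: (measurable_fhist_pred t' (fun h => ~~ fstop h)).
    exact: (measurable_fhist_pred t (fun h => fstop h /\ part_equiv G (frec h))).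
  apply/seteqP; split=> w.
    move=> [t [nst [st ok]]]; exists t => //; split; first by move=> t' /nst; rewrite stop_fhist.
    by rewrite /= -stop_fhist -rec_fhist.
  move=> [t _ [nst [st ok]]]; exists t; rewrite stop_fhist rec_fhist; split => //.
  by move=> t' /nst; rewrite /= stop_fhist.
move=> w [t [nst [st ok]]]; rewrite /E /=.
have [k [kn -> nstk stk]] := stopped_fhistP n w.
case: (boolP (fstop (fhist k w))) => //= sk.
suff -> : k = t by apply/asboolP; rewrite -rec_fhist.
apply/eqP; rewrite eqn_leq (leqNgt k t) (leqNgt t k); apply/andP; split; apply/negP.
  by move=> /nstk; rewrite -stop_fhist st.
by move=> /nst; rewrite stop_fhist sk.
Qed.

(** The length of the stopped prefix is the minimum of [tau] and [n]. *)
Lemma integral_tau_ge n :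
  ((stopped_sum fstop n (fun h => hist_prob h * (size h)%:R) [::])%:E <=
   \int[P]_w tau pi U Y w)%E.
Proof.
rewrite -(integral_stopped_prefix n (fun h => (size h)%:R)).
apply: ge0_le_integral_nonmeas => w; first by rewrite lee_fin.
have [k [kn -> nstk stk]] := stopped_fhistP n w.
apply: le_ereal_inf_tmp => _ [t /= st <-]; rewrite lee_fin ler_nat size_fhist leqNgt.
by apply/negP => /nstk; rewrite -stop_fhist st.
Qed.

End Law.
End Process.

(** * The grid of pairs *)

Section Labels.
Context {N K : nat}.
Hypotheses (K_ge2 : (2 <= K)%N) (N_ge2K : (2 * K <= N)%N).

(* Row [0] is left out: its arms keep their labels, which fixes the naming of the groups. *)
Definition nrows := (N %/ K).-1.
Definition npairs_col := K./2.
Local Notation I := ('I_nrows * 'I_npairs_col)%type.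

Definition super (a : nat) : nat := (a %% K)./2.
(** Arm [a] sits in row [a %/ K] and column [a %% K]. Besides row 0, the value is [None] on the
    incomplete last row and, for odd [K], on the last column, which has no partner. *)
Definition pair_of (a : nat) : option I :=
  if (a %/ K)%N is r.+1 then
    if insub r is Some q then
      if insub (super a) is Some j then Some (q, j) else None
    else None
  else None.
Definition bit (s : {ffun I -> bool}) (a : nat) : bool :=
  odd (a %% K) (+) (if pair_of a is Some i then s i else false).

Let K_gt0 : (0 < K)%N. Proof. exact: ltnW. Qed.

Lemma super_lt a : (super a < K)%N.
Proof. by clear N_ge2K; rewrite /super; have := ltn_pmod a K_gt0; lia. Qed.

Lemma bitE s a : bit s a = odd (a %% K) (+) (if pair_of a is Some i then s i else false).
Proof. by []. Qed.

Lemma pair_ofP a i : pair_of a = Some i ->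
  (a %/ K)%N = i.1.+1 /\ super a = i.2.
Proof.
rewrite /pair_of; case: (a %/ K)%N => // r.
by case: insubP => // q _ qr; case: insubP => // j _ jE [<-] /=; rewrite -qr -jE.
Qed.

Lemma pair_of_super a i : pair_of a = Some i -> (super a < K./2)%N.
Proof. by move=> /pair_ofP[_ ->]; exact: ltn_ord. Qed.

(** An arm outside all pairs keeps its column as label; an arm of a pair has its column and the
    neighbouring one both below [K]. An unpaired last column is thus never sent to label [K]. *)
Lemma label_subproof s a : ((super a).*2 + bit s a < K)%N.
Proof.
clear N_ge2K.
have := ltn_pmod a K_gt0; have := odd_double_half (a %% K); rewrite bitE -/(super a).
case pE: (pair_of a) => [i|]; last by rewrite addbF; lia.
by have := pair_of_super pE; lia.
Qed.

Definition label s : {ffun 'I_N -> 'I_K} := [ffun a : 'I_N => Ordinal (label_subproof s a)].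

Lemma label_eqP s (a b : 'I_N) :
  label s a = label s b <-> super a = super b /\ bit s a = bit s b.
Proof.
rewrite !ffunE; split=> [[]|[sab bab]]; last by apply: val_inj; rewrite /= sab bab.
by case: (bit s a); case: (bit s b) => /=; split=> //; lia.
Qed.

(** Swapping within pairs only permutes the labels of a complete row, so each such row meets every
    group. Each group therefore has at least [N %/ K] arms. *)
Lemma label_row s (k : 'I_K) r : (r < N %/ K)%N ->
  exists a : 'I_N, (a %/ K)%N = r /\ label s a = k.
Proof.
move=> rN; set a0 := (r * K + k)%N; have kK := ltn_ord k.
set b := if pair_of a0 is Some i then s i else false.
(* The arm sought is in column [k], or in its partner column when the pair is swapped. *)
set c := ((k./2).*2 + (odd k (+) b))%N.
have a0r : (a0 %/ K)%N = r by rewrite /a0 divnMDl// divn_small// addn0.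
have a0c : (a0 %% K)%N = k by rewrite /a0 modnMDl modn_small.
have cK : (c < K)%N.
  rewrite /c /b; have := odd_double_half k.
  case pE: (pair_of a0) => [i|]; last by rewrite addbF; lia.
  by have := pair_of_super pE; rewrite /super a0c; lia.
have a1N : (r * K + c < N)%N.
  apply: (@leq_trans (r.+1 * K)%N); first by rewrite mulSn addnC ltn_add2r.
  by apply: leq_trans (leq_trunc_div N K); rewrite leq_mul2r rN orbT.
have a1r : ((r * K + c) %/ K)%N = r by rewrite divnMDl// divn_small// addn0.
have a1c : ((r * K + c) %% K)%N = c by rewrite modnMDl modn_small.
have ch : c./2 = k./2 by rewrite /c; case: (_ (+) _); lia.
have sup : super (r * K + c) = super a0 by rewrite /super a1c a0c ch.
exists (Ordinal a1N); split => //; rewrite ffunE; apply: val_inj => /=.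
rewrite bitE a1c sup.
have -> : pair_of (r * K + c) = pair_of a0 by rewrite /pair_of a1r a0r sup.
rewrite -/b /super a0c /c oddD odd_double /= oddb addbK.
by rewrite addnC odd_double_half.
Qed.

Lemma card_label s (k : 'I_K) : (N %/ K <= #|[pred a | label s a == k]|)%N.
Proof.
rewrite -[leqLHS]card_ord.
have /fin_all_exists[f fP] : forall r : 'I_(N %/ K), exists a : 'I_N, (a %/ K)%N = r /\ label s a = k.
  by move=> r; exact: label_row.
have fi : injective f.
  move=> r r' ff; apply: val_inj; have [fr _] := fP r; have [fr' _] := fP r'.
  by rewrite /= -fr -fr' ff.
rewrite -(card_imset _ fi); apply: subset_leq_card; apply/fintype.subsetP => _ /imsetP[r _ ->].
by rewrite inE; have [_ ->] := fP r.
Qed.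

Lemma NK_ge2 : (2 <= N %/ K)%N.
Proof. by rewrite leq_divRL. Qed.

Lemma label_surj s (k : 'I_K) : exists a, label s a = k.
Proof.
have [a [_ ak]] := label_row s k (ltnW NK_ge2); by exists a.
Qed.

Lemma pair_of_anchor (i : I) : exists a : 'I_N, pair_of a = Some i.
Proof.
case: i => q j; have qN : (q < (N %/ K).-1)%N := ltn_ord q; have jK : (j < K./2)%N := ltn_ord j.
have cK : (j.*2 < K)%N by have := odd_double_half K; lia.
have aN : (q.+1 * K + j.*2 < N)%N.
  apply: (@leq_trans (q.+2 * K)%N); first by rewrite [(q.+2 * K)%N]mulSn addnC ltn_add2r.
  by apply: leq_trans (leq_trunc_div N K); rewrite leq_mul2r; apply/orP; right; lia.
exists (Ordinal aN); rewrite /= /pair_of /super divnMDl// divn_small// addn0 modnMDl modn_small//.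
by rewrite doubleK !valK.
Qed.

Lemma label_inj s s' (G : {ffun 'I_N -> 'I_K}) :
  part_equiv (label s) G -> part_equiv (label s') G -> s = s'.
Proof.
move=> [p pP] [p' p'P].
have pp' k : p k = p' k.
  have kN : (k < N)%N by apply: (leq_trans (ltn_ord k)); lia.
  have lk t : label t (Ordinal kN) = k.
    rewrite ffunE; apply: val_inj; rewrite /= bitE /super /pair_of divn_small// modn_small// addbF.
    by rewrite addnC odd_double_half.
  by have := p'P (Ordinal kN); rewrite (pP (Ordinal kN)) !lk.
have ll a : label s a = label s' a by apply: (@perm_inj _ p); rewrite -pP pp' -p'P.
apply/ffunP => i; have [a ai] := pair_of_anchor i.
have := ll a; rewrite !ffunE => -[]; rewrite !bitE ai.
by move=> /addnI; case: (odd _); case: (s i); case: (s' i).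
Qed.

Lemma sum_pair_of a : (\sum_i (pair_of a == Some i) <= 1)%N.
Proof.
case: (pair_of a) => [i|]; last by rewrite big1.
by rewrite (bigD1 i)//= eqxx big1// => k ki; case: eqP => // -[ik]; rewrite ik eqxx in ki.
Qed.

Lemma sum_super a : (\sum_(i : I) (super a == i.2) <= nrows)%N.
Proof.
rewrite -(pair_bigA _ (fun (q : 'I_nrows) (j : 'I_npairs_col) => (super a == j : nat))) /=.
rewrite sum_nat_const card_ord -[leqRHS]muln1 leq_mul2l; apply/orP; right.
case: (ltnP (super a) npairs_col) => aJ.
  rewrite (bigD1 (Ordinal aJ))//= eqxx big1// => k kne.
  by case: eqP => // ak; case/eqP: kne; apply: val_inj; rewrite /= ak.
by rewrite big1// => k _; case: eqP => // ak; have := ltn_ord k; rewrite -ak ltnNge aJ.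
Qed.

Lemma bit_flip s i a : bit (flip s i) a = bit s a (+) (pair_of a == Some i).
Proof.
rewrite !bitE; case: (pair_of a) => [k|]; last by rewrite !addbF.
by rewrite ffunE addbA (inj_eq (@Some_inj _)).
Qed.

Lemma npairs_col_ge : (K <= 3 * npairs_col)%N.
Proof. by rewrite /npairs_col; have := odd_double_half K; lia. Qed.

(** Leaving out row 0 and the incomplete row costs at most a factor 3, as [n + 1 <= 3 * (n - 1)] for
    [n >= 2]. With [npairs_col_ge], there are at least [N / 9] pairs. *)
Lemma nrows_ge : (N <= 3 * nrows * K)%N.
Proof.
rewrite /nrows; have := NK_ge2; have := ltn_ceil N K_gt0; move: (N %/ K)%N => n; nia.
Qed.

Lemma card_pairs : #|{: I}| = (nrows * npairs_col)%N.
Proof. by rewrite card_prod !card_ord. Qed.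

End Labels.

(** * A Bernoulli moment generating function and the hard instances *)

Section BernoulliMgf.
Context {R : realType}.
Implicit Types p l t : R.

Lemma expR_quadratic_bound t : expR t - 1 - t <= t ^+ 2 * Num.max 1 (expR t).
Proof.
have et : expR t - 1 - t <= t * (expR t - 1).
  have := expR_ge1Dx (- t); rewrite -(ler_pM2r (expR_gt0 t)) -expRD addNr expR0.
  by move=> h; rewrite -subr_ge0 (_ : _ - _ = 1 - (1 - t) * expR t); [rewrite subr_ge0|ring].
apply: le_trans et _; have [t0|t0] := leP 0 t.
  rewrite expr2 -mulrA ler_wpM2l//.
  apply: (@le_trans _ _ (t * expR t)); last by rewrite ler_wpM2l// le_max lexx orbT.
  have := expR_ge1Dx (- t); rewrite -(ler_pM2r (expR_gt0 t)) -expRD addNr expR0; lra.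
have := expR_ge1Dx t => h.
apply: (@le_trans _ _ (t ^+ 2)); last by rewrite ler_peMr ?sqr_ge0// le_max lexx.
rewrite expr2 -subr_ge0 -mulrBr mulr_le0 ?(ltW t0)//; lra.
Qed.

(* A weak form of the Kearns-Saul inequality: a Bernoulli variable of small mean
   [expR (- l)] has variance proxy of order [l^-1]. *)
Lemma bernoulli_mgf_small l t : 0 < l ->
  expR (- l) * expR (t * (1 - expR (- l))) + (1 - expR (- l)) * expR (t * (0 - expR (- l))) <=
  expR (2 * t ^+ 2 / l).
Proof.
move=> l0; set p := expR (- l); have p0 : 0 < p := expR_gt0 _.
have p1 : p < 1 by rewrite expR_lt1 oppr_lt0.
(* For [t > l / 2] the crude bound [expR t] is already below [expR (2 * t ^+ 2 / l)]. *)
have [tl|tl] := leP t (l / 2); last first.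
  apply: (@le_trans _ _ (expR t)).
    have e1 : expR (t * (1 - p)) <= expR t.
      have t0 : 0 < t by apply: lt_trans tl; rewrite divr_gt0.
      by rewrite ler_expR ler_piMr ?(ltW t0)//; lra.
    have e2 : expR (t * (0 - p)) <= expR t.
      rewrite ler_expR; have t0 : 0 < t by apply: lt_trans tl; rewrite divr_gt0.
      by rewrite ler_piMr ?(ltW t0)//; lra.
    have := expR_gt0 t => e0.
    rewrite (_ : expR t = p * expR t + (1 - p) * expR t); last by ring.
    by apply: lerD; apply: ler_wpM2l => //; rewrite ?subr_ge0 ltW.
  rewrite ler_expR -subr_ge0 (_ : _ - _ = t / l * (2 * t - l)); last by field; rewrite gt_eqF.
  have t0 : 0 < t by apply: lt_trans tl; rewrite divr_gt0.
  by rewrite mulr_ge0 ?divr_ge0 ?ltW//; lra.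
have -> : p * expR (t * (1 - p)) + (1 - p) * expR (t * (0 - p)) =
   (1 + p * (expR t - 1)) * expR (- (t * p)).
  rewrite mulrBr mulr1 expRD mulrBr mulr0 sub0r; ring.
apply: (@le_trans _ _ (expR (p * (expR t - 1)) * expR (- (t * p)))).
  by rewrite ler_wpM2r ?expR_ge0// expR_ge1Dx.
rewrite -expRD ler_expR.
rewrite (_ : _ - _ = p * (expR t - 1 - t)); last by ring.
apply: (@le_trans _ _ (p * (t ^+ 2 * Num.max 1 (expR t)))).
  by rewrite ler_wpM2l ?(ltW p0)// expR_quadratic_bound.
suff pm : p * Num.max 1 (expR t) <= 2 / l.
  by rewrite mulrCA (_ : _ / l = t ^+ 2 * (2 / l)) 1?ler_wpM2l ?sqr_ge0//; ring.
(* As [t <= l / 2], the small mean [expR (- l)] absorbs [expR t] and leaves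
   [expR (- (l / 2)) <= 2 / l]. *)
apply: (@le_trans _ _ (expR (- (l / 2)))).
  have /orP[/eqP ->|/eqP ->] : (Num.max 1 (expR t) == 1) || (Num.max 1 (expR t) == expR t).
  - by rewrite /Num.max; case: ifP; rewrite eqxx ?orbT.
  - by rewrite mulr1 ler_expR; lra.
  - by rewrite -expRD ler_expR; lra.
rewrite expRN -[leRHS]invf_div lef_pV2 ?posrE ?expR_gt0 ?divr_gt0//.
by have := expR_ge1Dx (l / 2); lra.
Qed.

Definition tilt (g : R) (y : bool) : R := if y then (1 - g) / 2 else (1 + g) / 2.

(** The larger of the two means is handled by exchanging the outcomes 0 and 1, which changes [t]
    into [- t]. *)
Lemma bernoulli_mgf_tilt g y t : 0 < g -> g < 1 ->
  tilt g y * expR (t * (1 - tilt g y)) + (1 - tilt g y) * expR (t * (0 - tilt g y)) <=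
  expR (2 * t ^+ 2 / ln (2 / (1 - g))).
Proof.
move=> g0 g1; have h : 0 < 2 / (1 - g) by rewrite divr_gt0// subr_gt0.
have l0 : 0 < ln (2 / (1 - g)) by rewrite ln_gt0// ltr_pdivlMr ?subr_gt0//; lra.
have pE : expR (- ln (2 / (1 - g))) = (1 - g) / 2.
  by rewrite expRN lnK ?posrE// invf_div.
case: y => /=; first by have := bernoulli_mgf_small t l0; rewrite /= pE.
have := bernoulli_mgf_small (- t) l0; rewrite /= pE sqrrN; apply: le_trans.
rewrite addrC le_eqVlt; apply/orP; left; apply/eqP.
by congr (_ * expR _ + _ * expR _); field.
Qed.

End BernoulliMgf.

(** * Membership of the hard instances in the environment class *)

Section Family.
Context {R : realType} {N K d : nat} (K_ge2 : (2 <= K)%N) (N_ge2K : (2 * K <= N)%N).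
Local Notation I := ('I_(@nrows N K) * 'I_(@npairs_col K))%type.
Local Notation S := {ffun I -> bool}.
Local Notation V := {ffun 'I_d -> {ffun 'I_K -> bool}}.
Variables (g B sigma Delta th : R).
Hypotheses (g0 : 0 < g) (g1 : g < 1) (B0 : 0 <= B) (sigma0 : 0 < sigma) (Delta0 : 0 < Delta).
Hypothesis d_gt0 : (0 < d)%N.
(** Two groups with the same centre have means differing by [B * g] in absolute value in each
    coordinate, which gives [separation]. The bound [proxy] makes the exponent [2 * (t * B / sigma)
    ^+ 2 / ln (2 / (1 - g))] at most [t ^+ 2 / 2]. *)
Hypothesis separation : Delta ^+ 2 <= d%:R * (B * g) ^+ 2.
Hypothesis proxy : 4 * B ^+ 2 <= sigma ^+ 2 * ln (2 / (1 - g)).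
Hypothesis th_le : th <= (N %/ K)%:R / N%:R.

Definition super_ord (a : nat) : 'I_K := Ordinal (super_lt K_ge2 a).
Definition fam_theta (s : S) (v : V) (a : 'I_N) (i : 'I_d) : R :=
  tilt g (bit s a (+) v i (super_ord a)).
(* Groups [2j] and [2j+1] lie symmetrically around a known centre, and these centres
   are at distance at least [Delta + B] from each other in every coordinate. *)
Definition fam_off (a : 'I_N) : R := (@super K a)%:R * (B + Delta).

Lemma tilt01 y : 0 < tilt g y < 1.
Proof. have gg := g0; have gg1 := g1; by case: y; rewrite /tilt /=; apply/andP; split; lra. Qed.

Lemma fam_theta01 s v a i : 0 < fam_theta s v a i < 1.
Proof. exact: tilt01. Qed.

Lemma coord_le_vnorm (x : 'cV[R]_d) i : `|x i 0| <= vnorm x.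
Proof.
rewrite /vnorm -sqrtr_sqr ler_wsqrtr// (bigD1 i)//= lerDl.
by apply: sumr_ge0 => j _; rewrite sqr_ge0.
Qed.

Lemma fam_separation s v a b : label K_ge2 s a != label K_ge2 s b ->
  Delta <= vnorm (env_mean (fam_theta s v) fam_off B a - env_mean (fam_theta s v) fam_off B b).
Proof.
move=> nab.
have [sab|nsab] := eqVneq (@super K a) (@super K b).
  have bab : bit s a != bit s b by apply: contra nab => /eqP ?; apply/eqP/(label_eqP K_ge2 N_ge2K).
  have -> : vnorm (env_mean (fam_theta s v) fam_off B a - env_mean (fam_theta s v) fam_off B b) =
      Num.sqrt (d%:R * (B * g) ^+ 2).
    congr Num.sqrt; rewrite -[in RHS](card_ord d) mulr_natl -sumr_const; apply: eq_bigr => i _.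
    rewrite !mxE /fam_off sab /fam_theta (_ : super_ord a = super_ord b); last exact: val_inj.
    rewrite /tilt; move: bab; case: (bit s a); case: (bit s b) => // _; case: (v i _) => /=; field; done.
  by rewrite -(ger0_norm (ltW Delta0)) -sqrtr_sqr ler_wsqrtr.
apply: le_trans (coord_le_vnorm _ (Ordinal d_gt0)); rewrite !mxE /fam_off.
wlog sab : a b nab nsab / (@super K a < @super K b)%N.
  move=> W; have [ab|ba|//] := ltngtP (@super K a) (@super K b).
  - exact: W.
  - by rewrite distrC; apply: W => //; rewrite eq_sym.
  - by move=> E; rewrite E eqxx in nsab.
have /andP[ta0 ta1] := fam_theta01 s v a (Ordinal d_gt0).
have /andP[tb0 tb1] := fam_theta01 s v b (Ordinal d_gt0).
move: (fam_theta s v a _) (fam_theta s v b _) ta0 ta1 tb0 tb1 => x y x0 x1 y0 y1.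
have : (@super K a)%:R + 1 <= (@super K b)%:R :> R by rewrite natr1 ler_nat.
move: (@super K a)%:R (@super K b)%:R => m n mn.
rewrite distrC; apply: le_trans (ler_norm _).
have h1 : 0 <= (n - m - 1) * (B + Delta).
  by apply: mulr_ge0; [lra|rewrite addr_ge0 ?(ltW Delta0)].
have h2 : 0 <= B * (y - x + 1) by apply: mulr_ge0 => //; lra.
rewrite -subr_ge0.
rewrite (_ : _ - _ = (n - m - 1) * (B + Delta) + B * (y - x + 1)); last by ring.
exact: addr_ge0.
Qed.

Lemma fam_in_env_class s v :
  in_env_class (@unif2 R) (env_Y (fam_theta s v) fam_off B) Delta th sigma (label K_ge2 s).
Proof.
have t01 := fam_theta01 s v.
exists (env_mean (fam_theta s v) fam_off B); split.
- split=> a; first exact: arm_mean_env.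
  apply: arm_subgaussian_env => // i t.
  rewrite !(mulrA t (B / sigma)); rewrite /fam_theta. apply: le_trans (bernoulli_mgf_tilt (bit s a (+) v i (super_ord a)) (t * (B / sigma)) g0 g1) _.
  rewrite ler_expR.
  have gg := g0; have gg1 := g1; have l0 : 0 < ln (2 / (1 - g)) by rewrite ln_gt0// ltr_pdivlMr ?subr_gt0//; lra.
  rewrite ler_pdivrMr// -subr_ge0.
  rewrite (_ : _ - _ = (t / sigma) ^+ 2 / 2 * (sigma ^+ 2 * ln (2 / (1 - g)) - 4 * B ^+ 2)).
    by rewrite mulr_ge0 ?subr_ge0// divr_ge0// sqr_ge0.
  by field; rewrite gt_eqF.
- exact: label_surj.
- move=> a b; split=> [mab|].
    apply/eqP; apply: contraT => /(fam_separation v).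
    rewrite mab subrr /vnorm big1 ?sqrtr0 => [|i _]; last by rewrite mxE expr0n.
    by rewrite leNgt Delta0.
  move=> lab; have [sab bab] := (label_eqP K_ge2 N_ge2K s a b).1 lab; apply/matrixP => i j; rewrite !mxE /fam_off /fam_theta sab bab.
  by rewrite (_ : super_ord a = super_ord b)//; exact: val_inj.
- move=> a b; exact: fam_separation.
- move=> k; apply: le_trans th_le _.
  rewrite ler_wpM2r ?invr_ge0// ler_nat.
  apply: leq_trans (card_label K_ge2 N_ge2K s k) _.
  apply/eq_leq/eq_card => a; rewrite inE; apply/idP/idP; first by move=> ak; exact/mem_set.
  by move/set_mem.
Qed.

End Family.

(** * From coordinatewise potentials to the information bound *)

Section InformationBound.
Context {R : realType} {N K d : nat} (K_ge2 : (2 <= K)%N) (N_ge2K : (2 * K <= N)%N).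
Local Notation I := ('I_(@nrows N K) * 'I_(@npairs_col K))%type.
Local Notation S := {ffun I -> bool}.
Local Notation D := {ffun 'I_K -> bool}.
Local Notation V := {ffun 'I_d -> D}.
Local Notation X := {ffun 'I_d -> bool}.
Local Notation T := ('I_N * X)%type.
Variables (g B sigma Delta th delta : R).
Hypotheses (g0 : 0 < g) (g1 : g < 1) (B0 : 0 <= B) (sigma0 : 0 < sigma) (Delta0 : 0 < Delta).
Hypothesis d_gt0 : (0 < d)%N.
Hypothesis separation : Delta ^+ 2 <= d%:R * (B * g) ^+ 2.
Hypothesis proxy : 4 * B ^+ 2 <= sigma ^+ 2 * ln (2 / (1 - g)).
Hypothesis th_le : th <= (N %/ K)%:R / N%:R.
Variable pi : strategy R N K d.
Hypothesis pac : delta_PAC delta Delta th sigma pi.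
Variable bud : R.
Hypothesis budget : (worst_budget Delta th sigma pi <= bud%:E)%E.
Hypotheses (delta_lt : delta < 1 / 12).

Local Notation offs := (@fam_off R N K B Delta).

Definition coord (i : 'I_d) (h : seq T) : seq ('I_N * bool) := map (fun e : T => (e.1, e.2 i)) h.

(** Since [1 - tilt g y = tilt g (~~ y)], the likelihood of either outcome is a single [tilt] with
    the outcome added to its argument. *)
Definition coord_weight (s : S) (u : D) (l : seq ('I_N * bool)) : R :=
  \prod_(e <- l) tilt g (bit s e.1 (+) u (super_ord K_ge2 e.1) (+) ~~ e.2).

Lemma hist_weight_coord s v h :
  hist_weight (fam_theta K_ge2 g s v) h = \prod_i coord_weight s (v i) (coord i h).
Proof.
rewrite /hist_weight /coord_weight.
under [RHS]eq_bigr do rewrite big_map.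
rewrite [RHS]exchange_big /=; apply: eq_bigr => e _; apply: eq_bigr => i _.
rewrite /fam_theta; case: (e.2 i) => /=; first by rewrite addbF.
by rewrite addbT; case: (_ (+) _) => /=; rewrite /tilt; field.
Qed.

Variable prior : D -> R.
Hypotheses (prior_ge0 : forall u, 0 <= prior u) (prior_sum : \sum_u prior u = 1).

Definition mix_weight (s : S) (l : seq ('I_N * bool)) : R := \sum_u prior u * coord_weight s u l.

Let pv (v : V) : R := \prod_i prior (v i).
Let W (s : S) (h : seq T) : R := \sum_v pv v * hist_weight (fam_theta K_ge2 g s v) h.

(** The prior on sign vectors is a product over coordinates, as is the likelihood given the signs,
    so the mixture factors as well. *)
Lemma W_prod s h : W s h = \prod_i mix_weight s (coord i h).
Proof.
rewrite /mix_weight (bigA_distr_bigA (fun i u => prior u * coord_weight s u (coord i h))).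
by apply: eq_bigr => v _; rewrite hist_weight_coord /pv -big_split.
Qed.

Lemma pv_sum : \sum_v pv v = 1.
Proof.
rewrite /pv -(bigA_distr_bigA (fun (i : 'I_d) u => prior u)).
by rewrite big1// => i _; exact: prior_sum.
Qed.

Lemma pv_ge0 v : 0 <= pv v.
Proof. exact: prodr_ge0. Qed.

Local Notation fstop := (fstop pi offs B).
Local Notation alpha := (alpha pi offs B).
Let ok (s : S) : pred (seq T) := fok pi offs B (label K_ge2 s).

(** Guarantees on correctness and budget hold for each fixed [v]; by linearity they pass to the
    mixture. *)
Lemma W_expectation s H (f : seq T -> R) :
  stopped_sum fstop H (fun h => alpha h * W s h * f h) [::] =
  \sum_v pv v * stopped_sum fstop H
    (fun h => hist_prob pi offs B (fam_theta K_ge2 g s v) h * f h) [::].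
Proof.
under [RHS]eq_bigr do rewrite -stopped_sumZ.
rewrite -stopped_sum_sum; apply: eq_stopped_sum => h.
rewrite /W mulr_sumr mulr_suml; apply: eq_bigr => v _.
by rewrite /hist_prob !mulrA (mulrC (alpha h)).
Qed.

Variables (H Ta Tj : nat) (V1 : R).
Hypotheses (H_gt0 : (0 < H)%N) (H_large : 32 * bud <= H%:R)
  (Ta_large : 32 * bud <= #|{: I}|%:R * Ta.+1%:R)
  (Tj_large : 32 * ((@nrows N K)%:R * bud) <= #|{: I}|%:R * Tj.+1%:R).
Hypothesis I_gt0 : (0 < #|{: I}|)%N.
Hypothesis V1_gt0 : 0 < V1.

Definition few_samples (i : I) (l : seq ('I_N * bool)) : bool :=
  (count (fun e : 'I_N * bool => pair_of e.1 == Some i) l <= Ta)%N &&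
  (count (fun e : 'I_N * bool => @super K e.1 == i.2) l <= Tj)%N.

Hypothesis potential : forall s i, exists F : seq ('I_N * bool) -> R,
  [/\ F [::] <= V1, forall l, few_samples i l -> 0 <= F l,
      forall l a, few_samples i l -> (forall y, few_samples i (rcons l (a, y))) ->
        F (rcons l (a, true)) + F (rcons l (a, false)) <= F l &
      forall l, few_samples i l -> mix_weight s l ^+ 2 <= F l * mix_weight (flip s i) l].

Lemma information_bound : 3 / 5 * #|{: I}|%:R <= V1 ^+ d * delta.
Proof.
have t01 (s : S) (v : V) (a : 'I_N) i : 0 < fam_theta K_ge2 g s v a i < 1 by exact: fam_theta01.
have env s v := fam_in_env_class K_ge2 N_ge2K g0 g1 B0 sigma0 Delta0 d_gt0 separation proxy th_le s v.
have Vp : 0 < V1 ^+ d by exact: exprn_gt0.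
have W_ge0 s h : 0 <= W s h.
  apply: sumr_ge0 => v _; apply: mulr_ge0; first exact: pv_ge0.
  by apply: prodr_ge0 => e _; exact: obs_weight_ge0.
have few_coord i k h : few_samples i (coord k h) =
   (count (fun e : T => pair_of e.1 == Some i) h <= Ta)%N &&
   (count (fun e : T => @super K e.1 == i.2) h <= Tj)%N.
  by rewrite /few_samples !count_map.
apply: (@hypercube_bound R _ X I fstop ok alpha (alphaS pi offs B) W
  (fun i a => pair_of a == Some i) (fun i a => @super K a == i.2) delta bud (V1 ^+ d) H
  (@nrows N K) Ta Tj) => //.
- by move=> h; exact: alpha_ge0.
- by move=> h a; exact: alphaS_ge0.
- exact: alpha_nil.
- by move=> h a x; exact: alpha_rcons.
- by move=> h; exact: alpha_sum.
- by move=> s s' h /asboolP a /asboolP b; exact: (label_inj N_ge2K a b).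
- move=> s; rewrite W_expectation -[RHS]pv_sum; apply: eq_bigr => v _.
  by rewrite stopped_sum_prob ?mulr1.
- move=> s; rewrite W_expectation -[leLHS]mul1r -[X in X * _ <= _]pv_sum mulr_suml; apply: ler_sum => v _.
  apply: ler_wpM2l; first exact: pv_ge0.
  rewrite -lee_fin.
  apply: (@le_trans _ _ (@unif2 R (correct pi (@env_U R) (env_Y (fam_theta K_ge2 g s v) offs B) (label K_ge2 s)))).
    exact: (pac (realization_env _ _ (t01 s v)) (env s v)).
  exact: (probability_correct_le pi offs B (t01 s v) H (label K_ge2 s)).
- move=> s; rewrite W_expectation -[leRHS]mul1r -[X in _ <= X * _]pv_sum mulr_suml; apply: ler_sum => v _.
  apply: ler_wpM2l; first exact: pv_ge0.
  rewrite -lee_fin; apply: le_trans budget.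
  apply: le_trans (integral_tau_ge pi offs B (t01 s v) H) _.
  apply: ereal_sup_ubound => /=.
  do 6 eexists; split; [exact: (realization_env offs B (t01 s v))|exact: env|by []].
- exact: sum_pair_of.
- exact: sum_super.
move=> s i; have [F [F0 Fpos Fstep Fdom]] := potential s i.
(* Summing over a bit vector distributes over this product, so each coordinate decreases separately.
   The caps concern only the arms and are common to all coordinates. *)
exists (fun h => \prod_k F (coord k h)); split.
- rewrite -[X in V1 ^+ X]card_ord -prodr_const; apply: ler_prod => k _.
  by rewrite F0 Fpos.
- by move=> h Ch; apply: prodr_ge0 => k _; apply: Fpos; rewrite few_coord.
- move=> h a Ch Cha.
  rewrite (eq_bigr (fun x : X => \prod_k F (rcons (coord k h) (a, x k)))); last first.
    by move=> x _; apply: eq_bigr => k _; rewrite /coord map_rcons.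
  rewrite -(bigA_distr_bigA (fun k y => F (rcons (coord k h) (a, y)))).
  have Cy k y : few_samples i (rcons (coord k h) (a, y)).
    have := Cha [ffun=> y]; rewrite -(few_coord i k) /coord map_rcons /= ffunE; exact.
  apply: ler_prod => k _; rewrite big_bool /=; apply/andP; split.
    by rewrite addr_ge0// Fpos.
  by apply: Fstep; rewrite ?few_coord.
- move=> h Ch; rewrite !W_prod -prodrXl -big_split /=; apply: ler_prod => k _.
  by rewrite sqr_ge0 Fdom// few_coord.
Qed.

End InformationBound.

(** * The two potentials *)

Section FixedSignsPotential.
Context {R : realType} {N K : nat} (K_ge2 : (2 <= K)%N).
Local Notation I := ('I_(@nrows N K) * 'I_(@npairs_col K))%type.
Local Notation S := {ffun I -> bool}.
Local Notation D := {ffun 'I_K -> bool}.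
Variables (g : R).
Hypotheses (g0 : 0 < g) (g1 : g < 1).

Definition dirac_prior (u : D) : R := (u == [ffun=> false])%:R.

Lemma dirac_prior_ge0 u : 0 <= dirac_prior u.
Proof. exact: ler0n. Qed.

Lemma dirac_prior_sum : \sum_u dirac_prior u = 1.
Proof.
rewrite (bigD1 [ffun=> false])//= /dirac_prior eqxx big1 ?addr0// => u /negbTE ->.
by [].
Qed.

Lemma mix_weight_dirac s (l : seq ('I_N * bool)) :
  mix_weight K_ge2 g dirac_prior s l = \prod_(e <- l) tilt g (bit s e.1 (+) ~~ e.2).
Proof.
rewrite /mix_weight (bigD1 [ffun=> false])//= /dirac_prior eqxx mul1r big1 ?addr0.
  by apply: eq_bigr => e _; rewrite ffunE addbF.
by move=> u /negbTE ->; rewrite mul0r.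
Qed.

(** The second moment, for one observation, of the likelihood ratio between the Bernoulli laws of
    means [(1 - g) / 2] and [(1 + g) / 2]; it is one plus their chi-square divergence. *)
Definition chi2_factor : R := ((1 - g) ^+ 2 / (1 + g) + (1 + g) ^+ 2 / (1 - g)) / 2.

Lemma chi2_factorE : chi2_factor = 1 + 4 * g ^+ 2 / (1 - g ^+ 2).
Proof.
have h1 : 1 + g != 0 by rewrite lt0r_neq0// addr_gt0.
have h2 : 1 - g != 0 by rewrite lt0r_neq0// subr_gt0.
rewrite /chi2_factor (_ : 1 - g ^+ 2 = (1 - g) * (1 + g)); last by ring.
by field; rewrite h1 h2.
Qed.

Lemma chi2_factor_ge1 : 1 <= chi2_factor.
Proof.
rewrite chi2_factorE lerDl; apply: divr_ge0; first by rewrite mulr_ge0 ?sqr_ge0.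
by rewrite subr_ge0 expr_le1// ltW.
Qed.

Lemma fixed_signs_potential (Ta Tj : nat) (s : S) (i : I) :
  exists F : seq ('I_N * bool) -> R,
  [/\ F [::] <= chi2_factor ^+ Ta, forall l, few_samples Ta Tj i l -> 0 <= F l,
      forall l a, few_samples Ta Tj i l -> (forall y, few_samples Ta Tj i (rcons l (a, y))) ->
        F (rcons l (a, true)) + F (rcons l (a, false)) <= F l &
      forall l, few_samples Ta Tj i l ->
        mix_weight K_ge2 g dirac_prior s l ^+ 2 <= F l * mix_weight K_ge2 g dirac_prior (flip s i) l].
Proof.
pose inp (a : 'I_N) := pair_of a == Some i.
pose cnt (l : seq ('I_N * bool)) := count (fun e => inp e.1) l.
pose t (y : bool) := tilt g y.
have t0 y : 0 < t y by have /andP[] := tilt01 g0 g1 y.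
pose fac (e : 'I_N * bool) := let y := bit s e.1 (+) ~~ e.2 in
  if inp e.1 then t y ^+ 2 / t (~~ y) else t y.
have fac0 e : 0 < fac e.
  by rewrite /fac; case: ifP => _ //; rewrite divr_gt0// exprn_gt0.
(* An observation of the pair multiplies the expected product by [chi2_factor]; the exponent
   decreasing from [Ta] pays for it in advance. *)
pose F l := chi2_factor ^+ (Ta - cnt l) * \prod_(e <- l) fac e.
have c1 := chi2_factor_ge1; have c0 : 0 < chi2_factor by apply: lt_le_trans c1.
exists F; split.
- by rewrite /F /cnt /= subn0 big_nil mulr1.
- by move=> l _; rewrite mulr_ge0 ?exprn_ge0 ?(ltW c0)// prodr_ge0// => e _; exact: ltW.
- move=> l a _ /(_ true)/andP[cl _].
  have fsum : fac (a, true) + fac (a, false) = if inp a then chi2_factor else 1.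
    rewrite /fac /= /t /tilt /chi2_factor.
    have h1 : 1 + g != 0 by rewrite lt0r_neq0// addr_gt0.
    have h2 : 1 - g != 0 by rewrite lt0r_neq0// subr_gt0.
    by case: (inp a); case: (bit s a) => /=; field; rewrite ?h1 ?h2.
  have cr b : cnt (rcons l (a, b)) = (cnt l + inp a)%N.
    by rewrite /cnt -cats1 count_cat /= addn0.
  rewrite /F !cr -!cats1 !big_cat !big_seq1 -mulrDr -mulrDr fsum.
  move: cl; rewrite -/(cnt _) cr; case: (inp a) => cl; last by rewrite addn0 mulr1.
  rewrite addn1 in cl *; rewrite [X in _ <= chi2_factor ^+ X * _](_ : _ = (Ta - (cnt l).+1).+1).
    by rewrite exprS mulrA (mulrC chi2_factor) mulrAC.
  by rewrite -subSn// subSS.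
move=> l _; rewrite !mix_weight_dirac -prodrXl /F -mulrA -big_split /=.
rewrite -[leLHS]mul1r; apply: ler_pM => //.
- by apply: prodr_ge0 => e _; rewrite sqr_ge0.
- by rewrite exprn_ege1.
apply: ler_prod => e _; rewrite sqr_ge0 /= bit_flip /fac -/(inp e.1).
case: (inp e.1) => /=; last by rewrite addbF -/(t _) expr2.
by rewrite addbT addNb -/(t _) -/(t (~~ _)) divfK// gt_eqF.
Qed.

End FixedSignsPotential.

(** * Scalar potential for one pair of groups with a random sign *)

Section SignPotential.
Context {R : realFieldType}.
Variables (g : R) (Tn Tm : nat).
Hypotheses (g0 : 0 < g) (g1 : g < 1).

(* The likelihoods under the two signs are [f0 a0], [f1 a1] before the swap of a pair
   and [f0 a1], [f1 a0] after it; [f] collects the observations outside of the pair.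
   With [C = cosh cosh] and [S = sinh sinh], [(C + S)^2 / (C - S) = C + 3 S + 4 S^2 / (C - S)];
   [C] and [S] are martingales, and the last term is dominated by a product of two
   martingales, one for each of the coordinates [f] and [a]. *)
Definition pot_other (f0 f1 : R) (n : nat) : R :=
  (1 + g ^+ 2) ^+ (Tn - n) * (f0 ^+ 2 + f1 ^+ 2) / 4 - (1 - g ^+ 2) ^+ Tn / 2.

(** The cubes come from bounding [1 / (C - S)] by a multiple of [a0 + a1], which joins the square
    [((a0 - a1) / 2) ^+ 2]. The growth rate [1 + 3 * g ^+ 2] is the mean of [(1 + g) ^+ 3] and
    [(1 - g) ^+ 3]. *)
Definition pot_pair (a0 a1 : R) (m : nat) : R :=
  ((1 + 3 * g ^+ 2) ^+ (Tm - m) * (a0 ^+ 3 + a1 ^+ 3) - (1 - g ^+ 2) ^+ Tm * (a0 + a1)) / 4.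

Definition sign_pot (f0 f1 a0 a1 : R) (n m : nat) : R :=
  (f0 + f1) * (a0 + a1) / 4 + 3 * ((f0 - f1) * (a0 - a1) / 4) +
  4 / (1 - g ^+ 2) ^+ (Tn + Tm) * (pot_other f0 f1 n * pot_pair a0 a1 m).

Let u0 : 0 < 1 - g ^+ 2.
Proof. by rewrite subr_gt0 expr_lt1// ltW. Qed.

Let u1 : 1 - g ^+ 2 <= 1.
Proof. by rewrite gerBl sqr_ge0. Qed.

Lemma pot_other_ge f0 f1 n : (n <= Tn)%N -> f0 * f1 = (1 - g ^+ 2) ^+ n ->
  ((f0 - f1) / 2) ^+ 2 <= pot_other f0 f1 n.
Proof.
move=> nT ff; rewrite (_ : _ ^+ 2 = (f0 ^+ 2 + f1 ^+ 2) / 4 - f0 * f1 / 2); last by field.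
rewrite /pot_other ff lerB//.
  rewrite ler_pM2r ?invr_gt0// ler_peMl ?addr_ge0 ?sqr_ge0//.
  by rewrite exprn_ege1// lerDl sqr_ge0.
by rewrite ler_pM2r ?invr_gt0// ler_wiXn2l// ltW.
Qed.

Lemma pot_pair_ge a0 a1 m : 0 < a0 -> 0 < a1 -> (m <= Tm)%N -> a0 * a1 = (1 - g ^+ 2) ^+ m ->
  ((a0 - a1) / 2) ^+ 2 * (a0 + a1) <= pot_pair a0 a1 m.
Proof.
move=> a00 a10 mT aa.
rewrite (_ : _ * (a0 + a1) = (a0 ^+ 3 + a1 ^+ 3 - a0 * a1 * (a0 + a1)) / 4); last by field.
rewrite /pot_pair aa ler_pM2r ?invr_gt0// lerB//.
  apply: ler_peMl; first by rewrite addr_ge0// exprn_ge0// ltW.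
  by rewrite exprn_ege1// lerDl mulr_ge0// sqr_ge0.
by rewrite ler_pM2r ?addr_gt0// ler_wiXn2l// ltW.
Qed.

Lemma sign_pot_bound f0 f1 a0 a1 n m :
  0 < f0 -> 0 < f1 -> 0 < a0 -> 0 < a1 -> (n <= Tn)%N -> (m <= Tm)%N ->
  f0 * f1 = (1 - g ^+ 2) ^+ n -> a0 * a1 = (1 - g ^+ 2) ^+ m ->
  ((f0 * a0 + f1 * a1) / 2) ^+ 2 <= sign_pot f0 f1 a0 a1 n m * ((f0 * a1 + f1 * a0) / 2).
Proof.
move=> f00 f10 a00 a10 nT mT ff aa.
set C := (f0 + f1) * (a0 + a1) / 4; set s := (f0 - f1) * (a0 - a1) / 4.
have D1 : (f0 * a0 + f1 * a1) / 2 = C + s by rewrite /C /s; field.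
have D2 : (f0 * a1 + f1 * a0) / 2 = C - s by rewrite /C /s; field.
have D0 : 0 < C - s by rewrite -D2 divr_gt0// addr_gt0// mulr_gt0.
rewrite /sign_pot -/C -/s D1 D2.
have po := pot_other_ge nT ff; have pp := pot_pair_ge a00 a10 mT aa.
have w0 : 0 < (1 - g ^+ 2) ^+ (Tn + Tm) by exact: exprn_gt0.
rewrite -subr_ge0 (_ : _ - _ = 4 / (1 - g ^+ 2) ^+ (Tn + Tm) *
   (pot_other f0 f1 n * pot_pair a0 a1 m * (C - s) - s ^+ 2 * (1 - g ^+ 2) ^+ (Tn + Tm))); last first.
  by field; rewrite gt_eqF.
apply: mulr_ge0; first by rewrite divr_ge0// ltW.
rewrite subr_ge0.
apply: (@le_trans _ _ (((f0 - f1) / 2) ^+ 2 * (((a0 - a1) / 2) ^+ 2 * (a0 + a1)) * (C - s))); last first.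
  rewrite ler_pM2r//; apply: ler_pM => //; first exact: sqr_ge0.
  by rewrite mulr_ge0 ?sqr_ge0// addr_ge0// ltW.
(* It remains to see that [(a0 + a1) * (C - s)] is at least [(1 - g ^+ 2) ^+ (Tn + Tm)]. It
   dominates [(f0 + f1) / 2 * (a0 * a1)], and the mean of [f0] and [f1] is at least the root of
   [f0 * f1], hence at least [f0 * f1 <= 1] itself. *)
rewrite (_ : _ * (C - s) = s ^+ 2 * ((a0 + a1) * (C - s))); last by rewrite /s; field.
rewrite ler_wpM2l ?sqr_ge0//.
have x0 : 0 < (1 - g ^+ 2) ^+ n by exact: exprn_gt0.
have x1 : (1 - g ^+ 2) ^+ n <= 1 by rewrite exprn_ile1// ltW.
have fx : (1 - g ^+ 2) ^+ n <= (f0 + f1) / 2.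
  have h0 : 0 <= (f0 + f1) / 2 by rewrite divr_ge0// addr_ge0// ltW.
  rewrite -(@ler_pXn2r _ 2) ?nnegrE//; last exact: ltW.
  apply: (@le_trans _ _ (f0 * f1)); first by rewrite ff expr2 ler_piMl// ltW.
  rewrite -subr_ge0 (_ : _ - _ = ((f0 - f1) / 2) ^+ 2); last by field.
  exact: sqr_ge0.
apply: (@le_trans _ _ ((1 - g ^+ 2) ^+ n * (1 - g ^+ 2) ^+ m)).
  by rewrite -exprD ler_wiXn2l ?leq_add// ltW.
rewrite -aa -D2.
apply: (@le_trans _ _ ((f0 + f1) / 2 * (a0 * a1))).
  by rewrite ler_pM2r ?mulr_gt0.
rewrite -subr_ge0 (_ : _ - _ = (f0 * a1 ^+ 2 + f1 * a0 ^+ 2) / 2); last by field.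
by rewrite divr_ge0// addr_ge0// mulr_ge0 ?exprn_ge0 ?ltW.
Qed.

Definition sgn_factor (y : bool) : R := if y then 1 - g else 1 + g.

Lemma sign_pot_other_step f0 f1 a0 a1 n m y : (n < Tn)%N ->
  (sign_pot (f0 * sgn_factor y) (f1 * sgn_factor (~~ y)) a0 a1 n.+1 m +
   sign_pot (f0 * sgn_factor (~~ y)) (f1 * sgn_factor y) a0 a1 n.+1 m) / 2 =
  sign_pot f0 f1 a0 a1 n m.
Proof.
move=> nT; rewrite /sign_pot /pot_other -[(Tn - n)%N](@subnSK n)// (exprS (1 + g ^+ 2)).
move: (_ ^+ (Tn - n.+1)) (_ ^+ (Tn + Tm)) (_ ^+ Tn) (pot_pair _ _ _) => a b c e.
by case: y; rewrite /sgn_factor /=; move: b^-1 => b'; field.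
Qed.

Lemma sign_pot_pair_step f0 f1 a0 a1 n m y : (m < Tm)%N ->
  (sign_pot f0 f1 (a0 * sgn_factor y) (a1 * sgn_factor (~~ y)) n m.+1 +
   sign_pot f0 f1 (a0 * sgn_factor (~~ y)) (a1 * sgn_factor y) n m.+1) / 2 =
  sign_pot f0 f1 a0 a1 n m.
Proof.
move=> mT; rewrite /sign_pot /pot_pair -[(Tm - m)%N](@subnSK m)// (exprS (1 + 3 * g ^+ 2)).
move: (_ ^+ (Tm - m.+1)) (_ ^+ (Tn + Tm)) (_ ^+ Tm) (pot_other _ _ _) => a b c e.
by case: y; rewrite /sgn_factor /=; move: b^-1 => b'; field.
Qed.

End SignPotential.

(** * The potential for uniform signs *)

Section UniformSignsPotential.
Context {R : realType} {N K : nat} (K_ge2 : (2 <= K)%N).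
Local Notation I := ('I_(@nrows N K) * 'I_(@npairs_col K))%type.
Local Notation S := {ffun I -> bool}.
Local Notation D := {ffun 'I_K -> bool}.
Local Notation L := (seq ('I_N * bool)).
Variables (g : R).
Hypotheses (g0 : 0 < g) (g1 : g < 1).

Definition unif_prior (u : D) : R := 2^-1 ^+ K.

Lemma unif_prior_ge0 u : 0 <= unif_prior u.
Proof. by rewrite exprn_ge0. Qed.

Lemma unif_prior_sum : \sum_u unif_prior u = 1.
Proof.
rewrite sumr_const card_ffun card_bool card_ord -[_ *+ (_ ^ _)%N]mulr_natr natrX -exprMn.
by rewrite mulVf ?expr1n.
Qed.

Section Pair.
Variables (Ta Tj : nat) (s : S) (i : I).

Let sup (e : 'I_N * bool) : 'I_K := super_ord K_ge2 e.1.
Let inp (e : 'I_N * bool) : bool := pair_of e.1 == Some i.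

Lemma pair_super_lt : (i.2 < K)%N.
Proof. by apply: leq_trans (ltn_ord i.2) _; rewrite /npairs_col -{2}(odd_double_half K); lia. Qed.

Let k0 : 'I_K := Ordinal pair_super_lt.
Let yv (s : S) (e : 'I_N * bool) : bool := bit s e.1 (+) ~~ e.2.

Definition group_lik (s : S) (k : 'I_K) (x : bool) (l : L) : R :=
  \prod_(e <- l) (if sup e == k then tilt g (yv s e (+) x) else 1).

(** Uniform signs are independent fair bits, one per index [k], and each observation involves only
    the sign of its own pair of groups. Indices never observed contribute the factor 1. *)
Lemma mix_weight_unif s' (l : L) : mix_weight K_ge2 g unif_prior s' l =
  \prod_k ((group_lik s' k true l + group_lik s' k false l) / 2).
Proof.
rewrite /mix_weight.
transitivity (\sum_(u : D) \prod_k (2^-1 * group_lik s' k (u k) l)).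
  apply: eq_bigr => u _; rewrite big_split /= prodr_const card_ord; congr (_ * _).
  rewrite /group_lik exchange_big /=; apply: eq_bigr => e _.
  rewrite (bigD1 (sup e))//= eqxx big1 ?mulr1 => [|k /negbTE]; last by rewrite eq_sym => ->.
  by rewrite /yv addbAC.
rewrite -(bigA_distr_bigA (fun k x => 2^-1 * group_lik s' k x l)).
by apply: eq_bigr => k _; rewrite big_bool /= -mulrDr mulrC.
Qed.

Let inp_sup e : inp e -> sup e = k0.
Proof. by move=> /eqP /pair_ofP[_ se]; apply: val_inj. Qed.

(** For the two groups containing the pair [i], the likelihood under the sign [x] is
    [half * f x * a x]: the powers of [1/2], the observations outside of the pair, and those of the
    pair. All other groups are in [rest]. *)
Let half (l : L) : R := \prod_(e <- l) (if sup e == k0 then 2^-1 else 1).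
Let f (x : bool) (l : L) : R :=
  \prod_(e <- l) (if (sup e == k0) && ~~ inp e then sgn_factor g (yv s e (+) x) else 1).
Let a (x : bool) (l : L) : R := \prod_(e <- l) (if inp e then sgn_factor g (yv s e (+) x) else 1).
Let n (l : L) := count (fun e => (sup e == k0) && ~~ inp e) l.
Let m (l : L) := count inp l.
Let rest (s : S) (l : L) : R := \prod_(k | k != k0) ((group_lik s k true l + group_lik s k false l) / 2).

Let sgn0 y : 0 < sgn_factor g y.
Proof. by case: y; rewrite /sgn_factor ?subr_gt0 ?addr_gt0. Qed.

Let tiltE y : tilt g y = sgn_factor g y / 2.
Proof. by case: y. Qed.

Lemma group_lik_gt0 s' k x l : 0 < group_lik s' k x l.
Proof.
by apply: prodr_gt0 => e _; case: ifP => // _; rewrite tiltE divr_gt0.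
Qed.

Let f0 x l : 0 < f x l.
Proof. by apply: prodr_gt0 => e _; case: ifP. Qed.

Let a0 x l : 0 < a x l.
Proof. by apply: prodr_gt0 => e _; case: ifP. Qed.

Let rest0 s' l : 0 < rest s' l.
Proof. by apply: prodr_gt0 => k _; rewrite divr_gt0// addr_gt0// group_lik_gt0. Qed.

Let half0 l : 0 < half l.
Proof. by apply: prodr_gt0 => k _; case: ifP; rewrite ?invr_gt0. Qed.

Let sgnM y : sgn_factor g y * sgn_factor g (~~ y) = 1 - g ^+ 2.
Proof. by case: y; rewrite /sgn_factor /=; ring. Qed.

Let prod_pair (q : pred ('I_N * bool)) l :
  (\prod_(e <- l) (if q e then sgn_factor g (yv s e (+) false) else 1)) *
  (\prod_(e <- l) (if q e then sgn_factor g (yv s e (+) true) else 1)) = (1 - g ^+ 2) ^+ count q l.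
Proof.
rewrite -big_split /=; elim: l => [|e l IH]; first by rewrite big_nil expr0.
rewrite big_cons IH /=; case: (q e); last by rewrite !mul1r.
by rewrite addbF addbT sgnM -exprS.
Qed.

Let mix_s l : mix_weight K_ge2 g unif_prior s l =
  rest s l * half l * ((f false l * a false l + f true l * a true l) / 2).
Proof.
rewrite mix_weight_unif (bigD1 k0)//= mulrC -/(rest s l) -!mulrA; congr (_ * _).
suff gE x : group_lik s k0 x l = half l * (f x l * a x l) by rewrite !gE; field.
rewrite /group_lik /half /f /a -!big_split /=; apply: eq_bigr => e _; rewrite tiltE.
have := @inp_sup e; case: (inp e) => [/(_ isT) ->|_]; first by rewrite eqxx /= mul1r mulrC.
by rewrite /= mulr1 andbT; case: ifP => _; rewrite ?mulr1// mulrC.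
Qed.

Let yv_flip e : yv (flip s i) e = yv s e (+) inp e.
Proof. by rewrite /yv bit_flip -/(inp e) addbAC. Qed.

(** Swapping the pair acts on its own observations as a change of sign, so [a x] becomes [a (~~ x)]
    and nothing else moves. *)
Let mix_flip l : mix_weight K_ge2 g unif_prior (flip s i) l =
  rest s l * half l * ((f false l * a true l + f true l * a false l) / 2).
Proof.
rewrite mix_weight_unif (bigD1 k0)//= mulrC -!mulrA; congr (_ * _).
  apply: eq_bigr => k kk0; congr ((_ + _) / 2); apply: eq_bigr => e _; case: ifP => // /eqP ek;
  rewrite yv_flip; case: (boolP (inp e)) => [/inp_sup ek0|_]; rewrite ?addbF//;
  by rewrite -ek ek0 eqxx in kk0.
suff gE x : group_lik (flip s i) k0 x l = half l * (f x l * a (~~ x) l) by rewrite !gE /=; field.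
rewrite /group_lik /half /f /a -!big_split /=; apply: eq_bigr => e _; rewrite tiltE yv_flip.
have := @inp_sup e; case: (inp e) => [/(_ isT) ->|_].
  by rewrite eqxx /= mul1r mulrC addbT addbN addNb.
by rewrite /= addbF mulr1 andbT; case: ifP => _; rewrite ?mulr1// mulrC.
Qed.

Let few_n l : few_samples Ta Tj i l -> (n l <= Tj)%N.
Proof.
move=> /andP[_]; apply: leq_trans; apply: sub_count => e /= /andP[/eqP se _].
by apply/eqP; have := congr1 val se.
Qed.

Let few_m l : few_samples Ta Tj i l -> (m l <= Ta)%N.
Proof. by move=> /andP[]. Qed.

Let pot l := sign_pot g Tj Ta (f false l) (f true l) (a false l) (a true l) (n l) (m l).

Let pot_bound l : few_samples Ta Tj i l ->
  ((f false l * a false l + f true l * a true l) / 2) ^+ 2 <=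
  pot l * ((f false l * a true l + f true l * a false l) / 2).
Proof.
move=> Cl; apply: sign_pot_bound => //; [exact: few_n|exact: few_m|exact: prod_pair|exact: prod_pair].
Qed.

Let rest_step l x : sup (x, true) != k0 ->
  rest s (rcons l (x, true)) + rest s (rcons l (x, false)) = rest s l.
Proof.
move=> xk; set k := sup (x, true) in xk *.
have gr k' z b : group_lik s k' z (rcons l (x, b)) =
   group_lik s k' z l * (if k == k' then tilt g (yv s (x, b) (+) z) else 1).
  by rewrite /group_lik -cats1 big_cat big_seq1.
rewrite /rest (bigD1 k)//= [in X in _ + X](bigD1 k)//= [in RHS](bigD1 k)//=.
have oth b : \prod_(j | (j != k0) && (j != k))
    ((group_lik s j true (rcons l (x, b)) + group_lik s j false (rcons l (x, b))) / 2) =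
  \prod_(j | (j != k0) && (j != k)) ((group_lik s j true l + group_lik s j false l) / 2).
  apply: eq_bigr => j /andP[_ jk]; rewrite !gr eq_sym (negbTE jk).
  by rewrite !mulr1.
rewrite !oth -mulrDl !gr eqxx; congr (_ * _).
by rewrite /yv /=; case: (bit s x) => /=; rewrite /tilt; field.
Qed.

Lemma uniform_signs_potential : exists F : L -> R,
  [/\ F [::] <= sign_pot g Tj Ta 1 1 1 1 0 0, forall l, few_samples Ta Tj i l -> 0 <= F l,
      forall l x, few_samples Ta Tj i l -> (forall y, few_samples Ta Tj i (rcons l (x, y))) ->
        F (rcons l (x, true)) + F (rcons l (x, false)) <= F l &
      forall l, few_samples Ta Tj i l ->
        mix_weight K_ge2 g unif_prior s l ^+ 2 <= F l * mix_weight K_ge2 g unif_prior (flip s i) l].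
Proof.
exists (fun l => rest s l * half l * pot l); split.
- rewrite /pot /f /a /half /rest /n /m /= !big_nil big1 ?mul1r// => k _.
  by rewrite /group_lik !big_nil; field.
- move=> l Cl; rewrite mulr_ge0 ?mulr_ge0 ?(ltW (rest0 _ _)) ?(ltW (half0 _))//.
  have D0 : 0 < (f false l * a true l + f true l * a false l) / 2.
    by rewrite divr_gt0// addr_gt0// mulr_gt0.
  by rewrite -(pmulr_lge0 _ D0); apply: le_trans (pot_bound Cl); rewrite sqr_ge0.
- move=> l x _ Clx.
  have cE b : (if sup (x, b) == k0 then 2^-1 else 1 : R) = if sup (x, true) == k0 then 2^-1 else 1 by [].
  have fr b z : f z (rcons l (x, b)) = f z l *
     (if (sup (x, true) == k0) && ~~ inp (x, true) then sgn_factor g (yv s (x, b) (+) z) else 1).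
    by rewrite /f -cats1 big_cat big_seq1.
  have ar b z : a z (rcons l (x, b)) = a z l *
     (if inp (x, true) then sgn_factor g (yv s (x, b) (+) z) else 1).
    by rewrite /a -cats1 big_cat big_seq1.
  have hr b : half (rcons l (x, b)) = half l * (if sup (x, true) == k0 then 2^-1 else 1).
    by rewrite /half -cats1 big_cat big_seq1.
  have nr b : n (rcons l (x, b)) = (n l + ((sup (x, true) == k0) && ~~ inp (x, true)))%N.
    by rewrite /n -cats1 count_cat /= addn0.
  have mr b : m (rcons l (x, b)) = (m l + inp (x, true))%N.
    by rewrite /m -cats1 count_cat /= addn0.
  have nT := few_n (Clx true); have mT := few_m (Clx true).
  rewrite nr in nT; rewrite mr in mT.
  rewrite /pot !fr !ar !hr !nr !mr.
  (* The sampled arm is outside the two groups, in the pair, or in the groups but not in the pair;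
     the quantity preserved on average comes from [rest_step], [sign_pot_pair_step] or
     [sign_pot_other_step] accordingly. *)
  have := @inp_sup (x, true).
  case: (boolP (sup (x, true) == k0)) nT mT => [/eqP sx|nsx] nT mT; last first.
    have -> : inp (x, true) = false.
      by apply/negbTE; apply: contra nsx => /inp_sup ->.
    by move=> _; rewrite !mulr1 !addn0 -!mulrDl rest_step.
  have rr b : rest s (rcons l (x, b)) = rest s l.
    apply: eq_bigr => k kk0; congr ((_ + _) / 2); rewrite /group_lik -cats1 big_cat big_seq1 /=;
    by rewrite (_ : sup (x, b) == k = false) ?mulr1// (_ : sup (x, b) = k0)// eq_sym; exact/negbTE.
  rewrite !rr => _; case: (boolP (inp (x, true))) nT mT => ix /= nT mT.
    rewrite !mulr1 addn0 addn1 /yv /= !addbF !addbT negbK.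
    rewrite addn1 in mT; rewrite -(sign_pot_pair_step g Tj _ _ _ _ _ (bit s x) mT).
    by rewrite le_eqVlt; apply/orP; left; apply/eqP; field.
  rewrite !mulr1 addn0 addn1 /yv /= !addbF !addbT negbK.
  rewrite addn1 in nT; rewrite -(sign_pot_other_step g Ta _ _ _ _ _ (bit s x) nT).
  by rewrite le_eqVlt; apply/orP; left; apply/eqP; field.
- move=> l Cl; rewrite mix_s mix_flip exprMn [leRHS]mulrACA -expr2.
  rewrite ler_pM2l; last by rewrite exprn_gt0// mulr_gt0.
  exact: pot_bound.
Qed.

End Pair.
End UniformSignsPotential.

(** * Numerical bounds and choice of the parameters *)

Section ExponentialBounds.
Context {R : realType}.

Lemma expR1_le4 : expR 1 <= 4 :> R.
Proof.
have h : expR (1 / 2) <= 2 :> R.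
  have := expR_ge1Dx (- (1 / 2) : R); rewrite expRN => e1.
  have e0 := expR_gt0 (1 / 2 : R).
  have : (1 / 2 : R) * expR (1 / 2) <= 1.
    by rewrite -ler_pdivlMr// (div1r (expR _)); apply: le_trans e1; lra.
  by lra.
have -> : expR 1 = expR (1 / 2) ^+ 2 :> R by rewrite -expRM_natr; congr expR; field.
rewrite expr2; have e0 := expR_gt0 (1 / 2 : R).
by rewrite (_ : 4 = 2 * 2 :> R); [apply: ler_pM => //; exact: ltW|ring].
Qed.

Lemma expR_le_lin (n : nat) (z : R) : 0 <= z -> z <= n%:R -> expR z <= 1 + 4 ^+ n * z.
Proof.
move=> z0 zn.
have e1 : expR z - 1 <= z * expR z.
  have := expR_ge1Dx (- z); rewrite -(ler_pM2r (expR_gt0 z)) -expRD addNr expR0; lra.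
have e2 : expR z <= 4 ^+ n.
  apply: (@le_trans _ _ (expR 1 ^+ n)); first by rewrite -expRM_natl mulr1 ler_expR.
  by apply: lerXn2r; rewrite ?nnegrE ?expR_ge0// expR1_le4.
have e3 : z * expR z <= z * 4 ^+ n by exact: ler_wpM2l.
by rewrite mulrC in e3 *; lra.
Qed.

Lemma exprD1_le_expR (w : R) (T : nat) : 0 <= w -> (1 + w) ^+ T <= expR (w * T%:R).
Proof.
move=> w0; rewrite expRM_natr lerXn2r ?nnegrE ?expR_ge0 ?addr_ge0//.
exact: expR_ge1Dx.
Qed.

Lemma bernoulli_ineq (w : R) (T : nat) : 0 <= w -> w <= 1 -> 1 - w * T%:R <= (1 - w) ^+ T.
Proof.
move=> w0 w1; elim: T => [|T IH]; first by rewrite mulr0 subr0 expr0.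
rewrite exprS -natr1; have h : 0 <= 1 - w by rewrite subr_ge0.
apply: le_trans (ler_wpM2l h IH).
have : 0 <= w ^+ 2 * T%:R by rewrite mulr_ge0 ?sqr_ge0.
by move: T%:R => t; lra.
Qed.

(** The initial value is 1 plus a product of two differences of powers, of orders [g ^+ 2 * Tj] and
    [g ^+ 2 * Ta]: the subtracted terms are what makes the excess of order [g ^+ 4]. The constants
    are [64 * 5 * 193 <= 256 * 256]. *)
Lemma sign_pot_le_expR (g : R) (Tj Ta : nat) : 0 < g -> g ^+ 2 <= 1 / 4 ->
  g ^+ 2 * Tj%:R <= 1 -> g ^+ 2 * Ta%:R <= 1 ->
  sign_pot g Tj Ta 1 1 1 1 0 0 <= expR (256 * 256 * (g ^+ 4 * (Tj%:R * Ta%:R))).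
Proof.
move=> g0 w4 wj wa; have w0 : 0 < g ^+ 2 by exact: exprn_gt0.
rewrite /sign_pot /pot_other /pot_pair !subn0 !expr1n.
rewrite (_ : g ^+ 4 = (g ^+ 2) ^+ 2); last by rewrite -exprM.
move: (g ^+ 2) w0 w4 wj wa => w w0 w4 wj wa.
have wj0 : 0 <= w * Tj%:R by rewrite mulr_ge0// ltW.
have wa0 : 0 <= w * Ta%:R by rewrite mulr_ge0// ltW.
have q0 : 0 < 1 - w by lra.
have hk : ((1 - w) ^+ (Tj + Ta))^-1 <= 64.
  have h1 : (1 - w)^-1 <= 1 + 4 / 3 * w.
    rewrite -[leLHS]div1r ler_pdivrMr//.
    have : 0 <= w * (1 / 4 - w) by apply: mulr_ge0; lra.
    by lra.
  apply: (@le_trans _ _ (expR 1 ^+ 3)); last first.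
    rewrite (_ : 64 = 4 ^+ 3 :> R); last by ring.
    by apply: lerXn2r; rewrite ?nnegrE ?expR_ge0// expR1_le4.
  rewrite -exprVn -expRM_natl.
  apply: (@le_trans _ _ ((1 + 4 / 3 * w) ^+ (Tj + Ta))).
    by apply: lerXn2r => //; rewrite nnegrE ?invr_ge0; lra.
  apply: le_trans (exprD1_le_expR _ _) _; first by lra.
  rewrite ler_expR natrD.
  by move: Tj%:R Ta%:R wj wa wj0 wa0 => x y; lra.
have hF : (1 + w) ^+ Tj - (1 - w) ^+ Tj <= 5 * (w * Tj%:R).
  have := exprD1_le_expR Tj (ltW w0); have := expR_le_lin (n := 1) wj0 wj.
  have := @bernoulli_ineq w Tj (ltW w0) ltac:(lra).
  by rewrite expr1; lra.
have hA : (1 + 3 * w) ^+ Ta - (1 - w) ^+ Ta <= 193 * (w * Ta%:R).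
  have w30 : 0 <= 3 * w by lra.
  have := exprD1_le_expR Ta w30.
  have := @expR_le_lin 3 (3 * w * Ta%:R) ltac:(lra) ltac:(lra).
  have := @bernoulli_ineq w Ta (ltW w0) ltac:(lra).
  by rewrite (_ : 4 ^+ 3 = 64); [lra|ring].
have F0 : 0 <= (1 + w) ^+ Tj - (1 - w) ^+ Tj.
  by rewrite subr_ge0 lerXn2r ?nnegrE; lra.
have A0 : 0 <= (1 + 3 * w) ^+ Ta - (1 - w) ^+ Ta.
  by rewrite subr_ge0 lerXn2r ?nnegrE; lra.
apply: le_trans (expR_ge1Dx _).
have k0 : 0 <= ((1 - w) ^+ (Tj + Ta))^-1 by rewrite invr_ge0 exprn_ge0// ltW.
move: ((1 - w) ^+ (Tj + Ta))^-1 ((1 + w) ^+ Tj) ((1 - w) ^+ Tj) hk k0 hF F0 => k b1 b2 hk k0 hF F0.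
move: ((1 + 3 * w) ^+ Ta) ((1 - w) ^+ Ta) hA A0 => c1 c2 hA A0.
have FA : (b1 - b2) * (c1 - c2) <= (5 * (w * Tj%:R)) * (193 * (w * Ta%:R)).
  exact: ler_pM.
have FA0 : 0 <= (b1 - b2) * (c1 - c2) by exact: mulr_ge0.
have kFA : k * ((b1 - b2) * (c1 - c2)) <= 64 * ((5 * (w * Tj%:R)) * (193 * (w * Ta%:R))).
  exact: ler_pM.
have P0 : 0 <= (w * Tj%:R) * (w * Ta%:R) by exact: mulr_ge0.
rewrite (_ : w ^+ 2 * (Tj%:R * Ta%:R) = (w * Tj%:R) * (w * Ta%:R)); last by ring.
rewrite (_ : 64 * _ = 64 * (5 * 193) * ((w * Tj%:R) * (w * Ta%:R))) in kFA; last by ring.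
rewrite (_ : (1 + 1) * (1 + 1) / 4 + _ + _ = 1 + k * ((b1 - b2) * (c1 - c2))); last by field.
move: (k * _) (w * _ * _) kFA P0 => y z kFA P0; lra.
Qed.

End ExponentialBounds.

Section BiasChoice.
Context {R : realType}.

(* For large [x] the two biases [(1 -+ g) / 2] are exponentially close to [0] and [1];
   two-point distributions with step [B] are then still sub-Gaussian at scale [B^2 / x]. *)
Lemma bias_parameters (sigma Delta : R) (d : nat) : 0 < sigma -> 0 < Delta -> (0 < d)%N ->
  let x := Delta ^+ 2 / (d%:R * sigma ^+ 2) in
  exists g B, [/\ 0 < g < 1, 0 <= B, Delta ^+ 2 <= d%:R * (B * g) ^+ 2,
    4 * B ^+ 2 <= sigma ^+ 2 * ln (2 / (1 - g)) &
    ln (chi2_factor g) <= 64 * x /\ (x <= 1 / 32 -> g ^+ 2 = 8 * x)].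
Proof.
move=> s0 D0 d0 x; have dR : 0 < d%:R :> R by rewrite ltr0n.
have x0 : 0 < x by rewrite divr_gt0 ?mulr_gt0 ?exprn_gt0.
have xE : Delta ^+ 2 = d%:R * sigma ^+ 2 * x.
  by rewrite /x mulrC divfK// gt_eqF// mulr_gt0// exprn_gt0.
have s2 : 0 < sigma ^+ 2 by exact: exprn_gt0.
(* For small [x] the step is a fixed multiple of [sigma] and the bias carries the separation, with
   [g ^+ 2 = 8 * x] and [B ^+ 2 = sigma ^+ 2 / 8]. *)
have [xs|xl] := leP x (1 / 32).
  have g2 : Num.sqrt (8 * x) ^+ 2 = 8 * x by rewrite sqr_sqrtr// mulr_ge0// ltW.
  have B2 : Num.sqrt (sigma ^+ 2 / 8) ^+ 2 = sigma ^+ 2 / 8 by rewrite sqr_sqrtr// divr_ge0// ltW.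
  have gg0 : 0 < Num.sqrt (8 * x) by rewrite sqrtr_gt0 mulr_gt0.
  have gg1 : Num.sqrt (8 * x) < 1.
    by rewrite -(@ltr_pXn2r _ 2) ?nnegrE ?sqrtr_ge0// g2 expr1n; lra.
  exists (Num.sqrt (8 * x)), (Num.sqrt (sigma ^+ 2 / 8)); split.
  - by rewrite gg0 gg1.
  - exact: sqrtr_ge0.
  - rewrite exprMn g2 B2 xE le_eqVlt; apply/orP; left; apply/eqP; by field.
  - rewrite B2; set g := Num.sqrt (8 * x) in gg0 gg1 *.
    have h0 : 0 < (1 - g) / 2 by rewrite divr_gt0// subr_gt0.
    have ln2 : 1 / 2 <= ln (2 / (1 - g)).
      rewrite -[2 / _]invf_div lnV ?posrE//.
      have := @le_ln1Dx R ((1 - g) / 2 - 1) ltac:(lra).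
      by rewrite addrC subrK; lra.
    by have := ler_wpM2l (ltW s2) ln2; lra.
  split=> //; rewrite chi2_factorE// g2.
  have h34 : 0 < 1 - 8 * x by lra.
  have p0 : 0 <= 4 * (8 * x) / (1 - 8 * x) by rewrite divr_ge0 ?ltW//; lra.
  apply: (@le_trans _ _ (4 * (8 * x) / (1 - 8 * x))).
    by apply: le_ln1Dx; lra.
  rewrite ler_pdivrMr//.
  have := mulr_ge0 (ltW x0) (_ : 0 <= 1 / 32 - x).
  by rewrite subr_ge0 => /(_ xs); lra.
(* For large [x] the step grows as [B ^+ 2 = 4 * sigma ^+ 2 * x], and [p = (1 - g) / 2] is small
   enough to keep the proxy. Then [chi2_factor g <= p^-1], so its logarithm is still at most
   [64 * x]. *)
set p := expR (- (64 * x)).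
have p0 : 0 < p := expR_gt0 _.
have p4 : p <= 1 / 4.
  have e2 : 4 <= expR (64 * x).
    apply: (@le_trans _ _ (expR (1 * 2%:R))); last by rewrite ler_expR; lra.
    rewrite expRM_natr expr2 (_ : 4 = 2 * 2 :> R); last by ring.
    have := expR_ge1Dx (1 : R) => h; apply: ler_pM => //; lra.
  by rewrite /p expRN div1r lef_pV2 ?posrE ?expR_gt0//.
have lnp : ln (2 / (1 - (1 - 2 * p))) = 64 * x.
  rewrite (_ : 1 - (1 - 2 * p) = 2 * p); last by ring.
  rewrite (_ : 2 / _ = p^-1); last by field; rewrite gt_eqF.
  by rewrite lnV ?posrE// /p expRK opprK.
have B2 : (2 * sigma * Num.sqrt x) ^+ 2 = 4 * sigma ^+ 2 * x.
  by rewrite !exprMn sqr_sqrtr ?ltW//; ring.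
exists (1 - 2 * p), (2 * sigma * Num.sqrt x); split.
- by apply/andP; split; lra.
- by rewrite !mulr_ge0 ?sqrtr_ge0// ltW.
- rewrite exprMn B2 xE.
  have g4 : 1 <= 4 * (1 - 2 * p) ^+ 2.
    have : 0 <= (1 / 4 - p) * (3 / 4 - p) by apply: mulr_ge0; lra.
    lra.
  have : 0 <= d%:R * sigma ^+ 2 * x by apply: mulr_ge0; [apply: mulr_ge0|]; exact: ltW.
  by move=> /ler_wpM2l /(_ _ _ g4); lra.
- rewrite B2 lnp; have := mulr_gt0 s2 x0; lra.
split; last by move=> ?; lra.
rewrite -lnp ler_ln ?posrE.
- rewrite chi2_factorE; [|lra|lra].
  have p1 : 0 < p * (1 - p) by apply: mulr_gt0; lra.
  rewrite (_ : 1 - (1 - 2 * p) ^+ 2 = 4 * (p * (1 - p))); last by ring.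
  rewrite -subr_ge0 (_ : _ - _ = (2 - 3 * p) / (1 - p)); first by apply: divr_ge0; lra.
  by field; rewrite !gt_eqF//; lra.
- by apply: lt_le_trans (chi2_factor_ge1 _ _); lra.
- by rewrite divr_gt0//; lra.
Qed.

End BiasChoice.

(** By pigeonhole some group has at most [N %/ K] arms. As [card_label] gives this many to every
    group of the grid, any admissible [theta] is met by the hard instances. *)
Lemma env_nonempty_theta {R : realType} (Delta theta sigma : R) (N K d : nat) :
  (0 < K)%N -> env_nonempty Delta theta sigma N K d -> theta <= (N %/ K)%:R / N%:R.
Proof.
move=> K0 [d1 [T1 [P [U [Y [G [_ [mu [_ _ _ _ thG]]]]]]]]].
suff [k kN] : exists k, (#|[pred a | G a == k]| <= N %/ K)%N.
  apply: le_trans (thG k) _; rewrite ler_wpM2r ?invr_ge0// ler_nat.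
  apply: leq_trans _ kN; apply/eq_leq/eq_card => a; rewrite [RHS]inE; apply/idP/idP.
    by move/set_mem.
  by move=> ak; exact/mem_set.
apply/existsP; apply: contraT; rewrite negb_exists => /forallP big.
have sN : (\sum_(k < K) #|[pred a | G a == k]| = N)%N.
  rewrite -[RHS]card_ord -sum1_card (partition_big G predT)//=.
  by apply: eq_bigr => k _; rewrite sum1_card.
have : (K * (N %/ K).+1 <= N)%N.
  rewrite -[leqRHS]sN -[K in (K * _)%N]card_ord -sum_nat_const.
  by apply: leq_sum => k _; rewrite ltnNge big.
by have := ltn_ceil N K0; rewrite mulnC; lia.
Qed.

Lemma sign_pot1_gt0 {R : realFieldType} (g : R) (Tj Ta : nat) : 0 < g -> g < 1 ->
  0 < sign_pot g Tj Ta 1 1 1 1 0 0.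
Proof.
move=> g0 g1.
have := @sign_pot_bound R g Tj Ta g0 g1 1 1 1 1 0 0 ltr01 ltr01 ltr01 ltr01 (leq0n _) (leq0n _).
rewrite !expr0 !mulr1 (_ : (1 + 1) / 2 = 1); last by field.
by rewrite expr1n mulr1 => /(_ erefl erefl); apply: lt_le_trans.
Qed.

Section LowerBound.
Context {R : realType} {N K d : nat}.
Variables (sigma Delta th delta : R) (pi : strategy R N K d) (bud : R).
Hypotheses (K_ge2 : (2 <= K)%N) (N_ge2K : (2 * K <= N)%N) (d_gt0 : (0 < d)%N).
Hypotheses (sigma0 : 0 < sigma) (Delta0 : 0 < Delta) (delta0 : 0 < delta) (delta_lt : delta < 1 / 12).
Hypothesis th_le : th <= (N %/ K)%:R / N%:R.
Hypothesis pac : delta_PAC delta Delta th sigma pi.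
Hypothesis budget : (worst_budget Delta th sigma pi <= bud%:E)%E.

Local Notation M := (@nrows N K * @npairs_col K)%N.
Local Notation J := (@npairs_col K).
Let ell : R := ln (N%:R / delta).
Let D : R := sigma ^+ 2 / Delta ^+ 2.
(** Caps at 32 times the average number of samples per pair, respectively per two groups, so that
    each Markov bound loses [1/32]. *)
Let Ta := Num.truncn (32 * bud / M%:R).
Let Tj := Num.truncn (32 * bud / J%:R).

Let JK : (K <= 3 * J)%N. Proof. exact: npairs_col_ge. Qed.
Let J0 : (0 < J)%N. Proof. by have := JK; have := K_ge2; lia. Qed.
Let NM : (N <= 9 * M)%N.
Proof. by have := JK; have := nrows_ge K_ge2 N_ge2K; move: (@nrows N K) J => q j; nia. Qed.
Let N0 : (4 <= N)%N. Proof. by lia. Qed.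
Let M0 : (0 < M)%N. Proof. by have := NM; have := N0; lia. Qed.
Let MR : 0 < M%:R :> R. Proof. by rewrite ltr0n. Qed.
Let JR : 0 < J%:R :> R. Proof. by rewrite ltr0n. Qed.
Let NR : 0 < N%:R :> R. Proof. by rewrite ltr0n; have := N0; lia. Qed.
Let D0 : 0 < D. Proof. by rewrite divr_gt0// exprn_gt0. Qed.

Let y48 : 48 <= N%:R / delta.
Proof.
rewrite ler_pdivlMr//; have : (4 : R) <= N%:R by rewrite ler_nat.
by have := delta_lt; lra.
Qed.

Let ell0 : 0 < ell.
Proof. by rewrite ln_gt0//; have := y48; lra. Qed.

Let ell_le (v : R) : 3 / 5 * M%:R <= v * delta -> 0 < v -> ell <= 4 * ln v.
Proof.
move=> Mv v0; set y := N%:R / delta.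
have y0 : 0 < y by have := y48; rewrite -/y; lra.
have yv : y <= 15 * v.
  rewrite ler_pdivrMr// -mulrA; apply: le_trans (ler_wpM2l _ Mv) => //.
  have : N%:R <= 9 * M%:R :> R by rewrite -natrM ler_nat.
  lra.
(* The constant 15 is absorbed into a power: [15 ^ 4 <= 48 ^ 3 <= y ^+ 3]. *)
have v15 : y <= v ^+ 4.
  rewrite -(ler_pM2l (exprn_gt0 3 y0)).
  apply: (@le_trans _ _ ((15 * v) ^+ 4)).
    by rewrite -exprSr; apply: lerXn2r; rewrite ?nnegrE//; lra.
  rewrite exprMn; apply: ler_wpM2r; first by rewrite exprn_ge0// ltW.
  apply: (@le_trans _ _ (48 ^+ 3)); last by apply: lerXn2r; [rewrite nnegrE|rewrite nnegrE ltW|exact: y48].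
  by rewrite !exprS !expr0; lra.
have -> : 4 * ln v = ln (v ^+ 4) by rewrite lnXn// mulr_natl.
by rewrite /ell ler_ln ?posrE ?exprn_gt0.
Qed.

Let truncn_large (w : R) : 0 < w -> 32 * bud <= w * (Num.truncn (32 * bud / w)).+1%:R.
Proof. by move=> w0; rewrite [leRHS]mulrC -ler_pdivrMr// ltW// truncnS_gt. Qed.

Let truncn_small (w : R) : 0 < w -> 0 <= bud -> w * (Num.truncn (32 * bud / w))%:R <= 32 * bud.
Proof.
move=> w0 b0; rewrite [leLHS]mulrC -ler_pdivlMr// truncn_le.
by rewrite divr_ge0// ?mulr_ge0// ltW.
Qed.

Section Bounds.
Variables (g B : R).
Hypotheses (g0 : 0 < g) (g1 : g < 1) (B0 : 0 <= B).
Hypothesis separation : Delta ^+ 2 <= d%:R * (B * g) ^+ 2.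
Hypothesis proxy : 4 * B ^+ 2 <= sigma ^+ 2 * ln (2 / (1 - g)).

Let bound := @information_bound R N K d K_ge2 N_ge2K g B sigma Delta th delta g0 g1 B0 sigma0 Delta0
  d_gt0 separation proxy th_le pi pac bud budget delta_lt.

Let instance prior (p0 : forall u, 0 <= prior u) (p1 : \sum_u prior u = 1) (V1 : R) : 0 < V1 ->
  (forall s i, exists F : seq ('I_N * bool) -> R,
  [/\ F [::] <= V1, forall l, few_samples Ta Tj i l -> 0 <= F l,
      forall l a, few_samples Ta Tj i l -> (forall y, few_samples Ta Tj i (rcons l (a, y))) ->
        F (rcons l (a, true)) + F (rcons l (a, false)) <= F l &
      forall l, few_samples Ta Tj i l ->
        mix_weight K_ge2 g prior s l ^+ 2 <= F l * mix_weight K_ge2 g prior (flip s i) l]) ->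
  3 / 5 * M%:R <= V1 ^+ d * delta.
Proof.
move=> V10 pot; rewrite -(@card_pairs N K).
have := bound p0 p1 (H := (Num.truncn (32 * bud)).+1) (Ta := Ta) (Tj := Tj) _ _ _ _ _ V10 pot.
apply => //.
- by rewrite ltW// truncnS_gt.
- by rewrite card_pairs; exact: truncn_large.
- rewrite card_pairs natrM mulrCA -mulrA; apply: ler_wpM2l => //; exact: truncn_large.
- by rewrite card_pairs.
Qed.

Lemma fixed_signs_bound : 3 / 5 * M%:R <= (chi2_factor g ^+ Ta) ^+ d * delta.
Proof.
have c1 := chi2_factor_ge1 g0 g1.
apply: (instance (@dirac_prior_ge0 R K) (@dirac_prior_sum R K)).
  by rewrite exprn_gt0// (lt_le_trans _ c1).
by move=> s i; exact: fixed_signs_potential.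
Qed.

Lemma uniform_signs_bound : 3 / 5 * M%:R <= sign_pot g Tj Ta 1 1 1 1 0 0 ^+ d * delta.
Proof.
apply: (instance (@unif_prior_ge0 R K) (@unif_prior_sum R K)).
  exact: sign_pot1_gt0.
by move=> s i; exact: uniform_signs_potential.
Qed.

End Bounds.

Let x : R := Delta ^+ 2 / (d%:R * sigma ^+ 2).
Let dR : 0 < d%:R :> R. Proof. by rewrite ltr0n. Qed.
Let x0 : 0 < x. Proof. by rewrite divr_gt0 ?mulr_gt0 ?exprn_gt0. Qed.
Let dxD : d%:R * x * D = 1.
Proof.
rewrite /x /D; field.
by rewrite !gt_eqF.
Qed.

(** With [Ta = 0] the second moment would be 1 and [ell] at most 0: this is the origin of the term
    [N], uniformly in [Delta]. The second bound uses [d * x * D = 1]. *)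
Lemma arm_bound : (1 <= Ta)%N /\ D * ell <= 256 * Ta%:R.
Proof.
have [g [B [/andP[g0 g1] B0 sep prox [lnc _]]]] := bias_parameters sigma0 Delta0 d_gt0.
have c1 := chi2_factor_ge1 g0 g1; have c0 : 0 < chi2_factor g by apply: lt_le_trans c1.
have v0 : 0 < (chi2_factor g ^+ Ta) ^+ d by rewrite !exprn_gt0.
have fb := fixed_signs_bound g0 g1 B0 sep prox; have := ell_le fb v0.
rewrite -exprM lnXn// => lt; split.
  case: (posnP Ta) lt => // ->; rewrite mul0n mulr0n mulr0 => lt.
  by have := ell0; rewrite ltNge lt.
have : ell <= 256 * (Ta%:R * (d%:R * x)).
  apply: le_trans lt _; rewrite -[ln _ *+ _]mulr_natl natrM.
  have := ler_wpM2l (_ : 0 <= Ta%:R * d%:R :> R) lnc.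
  by rewrite mulr_ge0// -/x => /(_ isT); lra.
move/(ler_wpM2l (ltW D0)) => h; apply: le_trans h _.
rewrite [leLHS](_ : _ = 256 * Ta%:R * (d%:R * x * D)); last by ring.
by rewrite dxD mulr1.
Qed.

(** [truncn] vanishes on negative reals, while [Ta] is at least 1. *)
Lemma bud_ge0 : 0 <= bud.
Proof.
have [T1 _] := arm_bound; rewrite leNgt; apply/negP => b0.
have : (Ta < 1)%N; last by rewrite ltnNge T1.
rewrite ltnS truncn_le_nat; apply: (@le_lt_trans _ _ 0) => //.
by rewrite ler_pdivrMr// mul0r; lra.
Qed.

Lemma Ta_le : N%:R * Ta%:R <= 288 * bud.
Proof.
have := truncn_small MR bud_ge0; rewrite -/Ta => h.
have NM9 : N%:R <= 9 * M%:R :> R by rewrite -natrM ler_nat.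
have : N%:R * Ta%:R <= 9 * M%:R * Ta%:R :> R by apply: ler_wpM2r.
by lra.
Qed.

Lemma Tj_le : K%:R * Tj%:R <= 96 * bud.
Proof.
have := truncn_small JR bud_ge0; rewrite -/Tj => h.
have KJ3 : K%:R <= 3 * J%:R :> R by rewrite -natrM ler_nat.
have : K%:R * Tj%:R <= 3 * J%:R * Tj%:R :> R by apply: ler_wpM2r.
by lra.
Qed.

Lemma bud_ge_N : N%:R <= 288 * bud.
Proof.
apply: le_trans Ta_le; rewrite -[leLHS]mulr1 ler_wpM2l// ler1n.
by have [] := arm_bound.
Qed.

Lemma bud_ge_Nell : D * (N%:R * ell) <= 256 * 288 * bud.
Proof.
have [_ h] := arm_bound; rewrite mulrCA; apply: le_trans (ler_wpM2l (ltW NR) h) _.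
by rewrite mulrCA -mulrA; apply: ler_wpM2l; [exact: ler0n|exact: Ta_le].
Qed.

Let Z2 : R := d%:R * K%:R * N%:R * ell.
Let Z20 : 0 <= Z2. Proof. by rewrite !mulr_ge0// ltW. Qed.
Let KN : K%:R <= N%:R :> R. Proof. by rewrite ler_nat (leq_trans _ N_ge2K)// leq_pmull. Qed.

(* The term [D * sqrt Z2] is compared with the budget through squares; outside of the
   regime [x <= 1/32], [g^2 Tj <= 1], [g^2 Ta <= 1] it is dominated by the other two terms. *)
Lemma bud_ge_sqrt : D ^+ 2 * Z2 <= (4 ^+ 10 * bud) ^+ 2.
Proof.
have b0 := bud_ge0; have l0 := ltW ell0; have dD := ltW D0.
have bN := bud_ge_N; have bNl := bud_ge_Nell.
have Nl0 : 0 <= D * (N%:R * ell) by rewrite mulr_ge0// mulr_ge0// ltW.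
have c10 : 4 ^+ 10 = 256 * 256 * 16 :> R by ring.
have [xs|xl] := leP x (1 / 32); last first.
  have dD32 : d%:R * D <= 32.
    have : d%:R * D * x = 1 by rewrite mulrAC dxD.
    have : 0 <= d%:R * D * (x - 1 / 32) by rewrite mulr_ge0 ?subr_ge0 ?ltW// mulr_gt0.
    by lra.
  rewrite (_ : D ^+ 2 * Z2 = (d%:R * D) * (K%:R * (D * (N%:R * ell)))); last by rewrite /Z2; ring.
  apply: (@le_trans _ _ (32 * ((288 * bud) * (256 * 288 * bud)))).
    apply: ler_pM => //; first by rewrite mulr_ge0.
      by rewrite mulr_ge0.
    by apply: ler_pM => //; exact: le_trans bN.
  by rewrite c10; have := sqr_ge0 bud; lra.
(* If [d * K < N * ell], the square root is at most [N * ell], already bounded. Otherwise it is at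
   most [d * K], and by [large] a budget of order [d * K * D] suffices. *)
have [NldK|dKNl] := leP (N%:R * ell) (d%:R * K%:R); last first.
  apply: (@le_trans _ _ ((D * (N%:R * ell)) ^+ 2)).
    rewrite [leRHS]exprMn; apply: ler_wpM2l; first exact: sqr_ge0.
    rewrite /Z2 [leRHS]expr2 -mulrA; apply: ler_wpM2r; last exact: ltW.
    by apply: mulr_ge0; [exact: ler0n|].
  apply: lerXn2r; [by rewrite nnegrE|by rewrite nnegrE mulr_ge0// exprn_ge0|].
  by apply: le_trans bNl _; rewrite c10; lra.
have Z2dK : Z2 <= (d%:R * K%:R) ^+ 2.
  by rewrite /Z2 [leRHS]expr2 -mulrA; apply: ler_wpM2l => //; exact: mulr_ge0.
have [g [B [/andP[g0 g1] B0 sep prox [_ g2]]]] := bias_parameters sigma0 Delta0 d_gt0.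
have {}g2 := g2 xs; rewrite -/x in g2.
have large : d%:R * K%:R * D <= 4 ^+ 10 * bud -> D ^+ 2 * Z2 <= (4 ^+ 10 * bud) ^+ 2.
  move=> h; apply: (@le_trans _ _ ((d%:R * K%:R * D) ^+ 2)).
    by rewrite [leRHS]exprMn mulrC ler_wpM2r ?sqr_ge0.
  by apply: lerXn2r => //; rewrite nnegrE mulr_ge0// ?exprn_ge0// mulr_ge0.
(* If a cap [v] exceeds [1 / g ^+ 2 = 1 / (8 * x)], then [u * v <= c * bud] bounds [u / x], and
   [1 / x = d * D]. *)
have dDx u v c : 0 <= u -> u * v%:R <= c * bud -> 1 < g ^+ 2 * v%:R -> d%:R * u * D <= 8 * (c * bud).
  rewrite g2 => u0 uv v1.
  have : d%:R * D * (u * (8 * x * v%:R)) = 8 * (u * v%:R) * (d%:R * x * D) by ring.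
  rewrite dxD mulr1 => e1.
  apply: (@le_trans _ _ (d%:R * D * (u * (8 * x * v%:R)))); last by rewrite e1 ler_wpM2l.
  rewrite -mulrA [X in d%:R * X]mulrC mulrA; apply: ler_wpM2l; first by rewrite mulr_ge0.
  by rewrite ler_peMr// ltW.
have [gj|gj] := leP (g ^+ 2 * Tj%:R) 1; last first.
  apply: large; apply: le_trans (dDx _ _ 96 _ Tj_le gj) _ => //.
  by rewrite c10; lra.
have [ga|ga] := leP (g ^+ 2 * Ta%:R) 1; last first.
  apply: large; apply: (@le_trans _ _ (d%:R * N%:R * D)).
    by rewrite ler_wpM2r// ler_wpM2l.
  apply: le_trans (dDx _ _ 288 _ Ta_le ga) _ => //.
  by rewrite c10; lra.
have ub := uniform_signs_bound g0 g1 B0 sep prox.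
have pot_le : sign_pot g Tj Ta 1 1 1 1 0 0 <= expR (256 * 256 * (g ^+ 4 * (Tj%:R * Ta%:R))).
  by apply: sign_pot_le_expR => //; rewrite g2; lra.
have ub' : 3 / 5 * M%:R <= expR (256 * 256 * (g ^+ 4 * (Tj%:R * Ta%:R))) ^+ d * delta.
  apply: le_trans ub _; apply: ler_wpM2r; first exact: ltW.
  by apply: lerXn2r; rewrite ?nnegrE ?expR_ge0// ltW// sign_pot1_gt0.
have := ell_le ub' (exprn_gt0 _ (expR_gt0 _)).
rewrite -expRM_natl expRK (_ : g ^+ 4 = (g ^+ 2) ^+ 2); last by rewrite -exprM.
rewrite g2 => lt.
have dD2 : d%:R * x ^+ 2 * (d%:R * D ^+ 2) = 1.
  rewrite [LHS](_ : _ = (d%:R * x * D) ^+ 2); last by ring.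
  by rewrite dxD expr1n.
have {}lt : ell <= 256 * 256 * 256 * (d%:R * x ^+ 2 * (Tj%:R * Ta%:R)).
  by apply: le_trans lt _; rewrite le_eqVlt; apply/orP; left; apply/eqP; ring.
(* Here [ell] is of order at most [d * x ^+ 2 * Tj * Ta]. Multiplying by [D ^+ 2 * d * K * N]
   cancels [(d * x * D) ^+ 2 = 1] and leaves the two sampling totals. *)
have DZ : D ^+ 2 * Z2 <= 256 * 256 * 256 * ((K%:R * Tj%:R) * (N%:R * Ta%:R)).
  have c0 : 0 <= D ^+ 2 * (d%:R * K%:R * N%:R).
    by apply: mulr_ge0; [exact: sqr_ge0|rewrite -!natrM].
  have := ler_wpM2l c0 lt.
  rewrite (_ : _ * (256 * 256 * 256 * _) = 256 * 256 * 256 * ((K%:R * Tj%:R) * (N%:R * Ta%:R)) *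
    (d%:R * x ^+ 2 * (d%:R * D ^+ 2))); last by ring.
  by rewrite dD2 mulr1 /Z2 !mulrA.
apply: le_trans DZ _.
have KTNT : (K%:R * Tj%:R) * (N%:R * Ta%:R) <= (96 * bud) * (288 * bud).
  by apply: ler_pM; rewrite ?mulr_ge0// ?Tj_le// Ta_le.
rewrite c10; have := sqr_ge0 bud; move: KTNT; rewrite !expr2.
rewrite (_ : 96 * bud * (288 * bud) = 96 * 288 * (bud * bud)); last by ring.
rewrite (_ : 256 * 256 * 16 * bud * (256 * 256 * 16 * bud) = 256 * 256 * 256 * (256 * 16 * 16 * (bud * bud))); last by ring.
move: (bud * bud) (_ * _ * (_ * _)) => b2 kt h1 h2; lra.
Qed.

(** The three terms cost at most [288], [256 * 288] and [4 ^ 10] times the budget, and these add up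
    to less than [4 ^ 11]. *)
Lemma budget_lower_bound :
  (4 ^+ 11)^-1 * N%:R + (4 ^+ 11)^-1 * D * (N%:R * ell + Num.sqrt Z2) <= bud.
Proof.
have b0 := bud_ge0; have c0 : 0 < 4 ^+ 11 :> R by exact: exprn_gt0.
have DZ : D * Num.sqrt Z2 <= 4 ^+ 10 * bud.
  rewrite -(@ler_pXn2r _ 2)//.
  - by rewrite [leLHS]exprMn sqr_sqrtr//; exact: bud_ge_sqrt.
  - by rewrite nnegrE; apply: mulr_ge0; [exact: ltW|exact: sqrtr_ge0].
  - by rewrite nnegrE mulr_ge0// exprn_ge0.
rewrite -mulrA -mulrDr ler_pdivrMl// mulrDr.
have c11 : 4 ^+ 11 = 256 * 256 * 64 :> R by ring.
have c10 : 4 ^+ 10 = 256 * 256 * 16 :> R by ring.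
rewrite c11; rewrite c10 in DZ.
by have := bud_ge_N; have := bud_ge_Nell; lra.
Qed.

End LowerBound.

Local Close Scope classical_set_scope.

Theorem theorem1 :
  exists c : Rdefinitions.R, 0 < c /\
  forall (sigma Delta theta delta : Rdefinitions.R) (d N K : nat),
    0 < sigma -> 0 < Delta -> (1 <= d)%N -> 0 < theta ->
    0 < delta -> delta < 1 / 12 ->
    (4 <= 2 * K)%N -> (2 * K <= N)%N ->
    env_nonempty Delta theta sigma N K d ->
    ((c * N%:R + c * (sigma ^+ 2 / Delta ^+ 2) *
       (N%:R * ln (N%:R / delta) + Num.sqrt (d%:R * K%:R * N%:R * ln (N%:R / delta))))%:E
     <= Tstar delta Delta theta sigma N K d)%E.
Proof.
exists (4 ^+ 11)^-1; split; first by rewrite invr_gt0 exprn_gt0.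
move=> sigma Delta theta delta d N K s0 D0 d0 _ dl0 dl1 K4 NK ne.
have K2 : (2 <= K)%N by rewrite -(leq_pmul2l (isT : (0 < 2)%N)).
have th_le := env_nonempty_theta (ltnW K2) ne.
apply: le_ereal_inf_tmp => _ [pi pac <-].
have low bud : (worst_budget Delta theta sigma pi <= bud%:E)%E -> _ <= bud :=
  budget_lower_bound K2 NK d0 s0 D0 dl0 dl1 th_le pac.
case: (worst_budget Delta theta sigma pi) low => [r||] low.
- by rewrite lee_fin low.
- by rewrite leey.
(* A worst-case budget equal to minus infinity would lie below [X - 1], against the lower bound
   [X]. *)
- set X := (_ + _) in low *; have := low (X - 1) (leNye _).
  by rewrite lerBrDr gerDl ler10.
Qed.
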